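(* Let $p$ be a prime. (A) Let $m\in\mathbb N$ and let $\mu_\alpha=\bigotimes_{k=1}^m\mu_\alpha^k$, $\mu_\alpha^k=\bigotimes_{n=k+1}^\infty\mu_{\alpha_{kn}}$, be a product measure on $X^m$, where the $\mu_{\alpha_{kn}}$ are probability measures on $\mathbb F_p$ with $\mu_{\alpha_{kn}}(r)=\alpha_{kn}(r)>0$ for all $r$. If the quasiregular representation $T^{R,\mu_\alpha,m}$ of $B_0^{\mathbb N}(\mathbb F_p)$ on $L^2(X^m,\mu_\alpha)$ is irreducible, then 1) $\mu_\alpha^{L_t}\perp\mu_\alpha$ for all $t\in B(m,\mathbb F_p)\setminus\{e\}$; 2) $\mu_\alpha$ is ergodic for the right action of $B_0^{\mathbb N}(\mathbb F_p)$ on $X^m$; 3) $\mu_\alpha^k\perp\mu_{inv}^k$ for all $1\le k\le m$. (B) Let $\mu_\alpha=\bigotimes_{1\le k<n}\mu_{\alpha_{kn}}$ be a product measure on $B^{\mathbb N}(\mathbb F_p)$ with all $\alpha_{kn}(r)>0$. If the regular representation $T^{R,\mu_\alpha}$ of $B_0^{\mathbb N}(\mathbb F_p)$ on $L^2(B^{\mathbb N}(\mathbb F_p),\mu_\alpha)$ is irreducible, then 1) $\mu_\alpha^{L_t}\perp\mu_\alpha$ for all $t\in B_0^{\mathbb N}(\mathbb F_p)\setminus\{e\}$; 2) $\mu_\alpha$ is ergodic for the right action of $B_0^{\mathbb N}(\mathbb F_p)$ on $B^{\mathbb N}(\mathbb F_p)$.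
   Context: $B(m,\mathbb F_p)$ is the group of $m\times m$ upper triangular matrices over $\mathbb F_p$ with units on the diagonal. $B^{\mathbb N}(\mathbb F_p)$ is the group of all infinite upper triangular matrices $I+\sum_{1\le k<n}x_{kn}E_{kn}$, $x_{kn}\in\mathbb F_p$, and $B_0^{\mathbb N}(\mathbb F_p)$ is its subgroup with finitely many nonzero $x_{kn}$. $X^m$ is the set of arrays $x=(x_{kn})_{1\le k\le m,\,k<n}$, $x_{kn}\in\mathbb F_p$, viewed as the first $m$ rows of an infinite upper triangular matrix with units on the diagonal. The right action is $R_t(x)=xt^{-1}$ (matrix product; for $X^m$, of the $m\times\infty$ matrix $x$ with $t^{-1}$). The left action is $L_t(x)=tx$ (for $X^m$: $t\in B(m,\mathbb F_p)$; for $B^{\mathbb N}(\mathbb F_p)$: $t\in B_0^{\mathbb N}(\mathbb F_p)$). The representations are $(T_tf)(x)=\big(d\mu_\alpha(R_t^{-1}(x))/d\mu_\alpha(x)\big)^{1/2}f(R_t^{-1}(x))$. $\mu^f(\Delta)=\mu(f^{-1}(\Delta))$; $\perp$ means mutually singular. $\mu_{inv}^k=\bigotimes_{n=k+1}^\infty\mu_{inv}^{kn}$ with $\mu_{inv}^{kn}(r)=1/p$ for $r\in\mathbb F_p$. Ergodic means: every $f\in L^1$ with $f(R_t(x))=f(x)$ $\mu_\alpha$-a.e. for all $t$ in the group is constant $\mu_\alpha$-a.e. *)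

(* Defs.v *)
From HB Require Import structures.
From mathcomp Require Import all_boot all_order all_algebra complex.
From mathcomp Require Import all_classical all_reals all_analysis.

Set Implicit Arguments.
Unset Strict Implicit.
Unset Printing Implicit Defensive.

Import Order.TTheory GRing.Theory Num.Theory.
Import numFieldNormedType.Exports.

Local Open Scope classical_set_scope.
Local Open Scope ring_scope.

(* Discrete sigma-algebra on ordinals, hence on 'F_p. *)
HB.instance Definition _ n := isPointed.Build 'I_n.+1 ord0.
HB.instance Definition _ n := @isMeasurable.Build default_measure_display
  'I_n.+1 discrete_measurable discrete_measurable0
  discrete_measurableC discrete_measurableU.

(* 'F_p ^ I with the product sigma-algebra. *)
Definition cylinders (I : Type) (p : nat) : set (set (I -> 'F_p)) :=
  [set C | exists (i : I) (A : set 'F_p), C = [set x | A (x i)]].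

Definition conf (I : Type) (p : nat) := g_sigma_algebraType (@cylinders I p).

HB.instance Definition _ I p := Measurable.on (conf I p).

Lemma measurable_conf d (T : measurableType d) (I : Type) (p : nat)
    (f : T -> conf I p) :
  (forall i (v : 'F_p), measurable [set x | f x i = v]) ->
  measurable_fun setT f.
Proof.
move=> mf; apply: (@measurability _ _ _ (conf I p) _ _ (@cylinders I p)) => //.
move=> _ [_ [i [A ->]] <-]; rewrite setTI.
rewrite (_ : _ @^-1` _ = \bigcup_(v in A) [set x | f x i = v]); last first.
  apply/seteqP; split=> x /=; first by move=> Afx; exists (f x i).
  by case=> v Av /= ->.
apply: fin_bigcup_measurable; first exact: finite_finset.
by move=> v _; exact: mf.
Qed.

Lemma measurable_coord (I : Type) (p : nat) (i : I) (A : set 'F_p) :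
  measurable [set x : conf I p | A (x i)].
Proof. by apply: sub_sigma_algebra; exists i, A. Qed.

(* A map each coordinate of which depends on finitely many coordinates. *)
Lemma measurable_finitary (I I' : choiceType) (p : nat)
    (f : conf I p -> conf I' p) (D : I' -> seq I) :
  (forall i x y, {in D i, x =1 y} -> f x i = f y i) -> measurable_fun setT f.
Proof.
move=> Df; apply: measurable_conf => i v.
pose ext (g : {ffun 'I_(size (D i)) -> 'F_p}) : conf I p :=
  fun j => oapp g 0 (insub (index j (D i))).
rewrite (_ : [set _ | _] = \bigcup_(g in [set g | f (ext g) i = v])
    \bigcap_(j in [set j | j \in D i]) [set x : conf I p | x j = ext g j]); last first.
  apply/seteqP; split=> x /=.
    move=> fxv.
    pose g := [ffun k : 'I_(size (D i)) => x (tnth (in_tuple (D i)) k)].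
    have xg j : j \in D i -> x j = ext g j.
      move=> jD; rewrite /ext; case: insubP => [k _ kE|]; last by rewrite index_mem jD.
      by rewrite /= ffunE (tnth_nth j) /= kE nth_index.
    by exists g => //=; rewrite -fxv; apply/esym/Df => j /xg.
  by move=> [g /= <-] xg; apply: Df => j jD; exact: xg.
apply: fin_bigcup_measurable; first exact: finite_finset.
move=> g _; apply: fin_bigcap_measurable => [|j _]; first exact: finite_seq.
exact: (measurable_coord j [set ext g j]).
Qed.
Lemma fsbig_fintype (R : Type) (idx : R) (op : Monoid.com_law idx)
    (T : finType) (A : set T) (F : T -> R) :
  \big[op/idx]_(i \in A) F i = \big[op/idx]_(i in A) F i.
Proof.
rewrite [RHS]bigfs ?index_enum_uniq//; last by move=> i _; rewrite mem_index_enum.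
by rewrite set_mem_set.
Qed.

Section discrete_probability.
Context (R : realType) (p : nat) (P : probability 'F_p R).

Lemma probability_atoms (A : set 'F_p) :
  P A = (\sum_(v in A) fine (P [set v]))%:E.
Proof.
have fA : finite_set A by exact: finite_finset.
have tA : trivIset A (fun v => [set v]) by move=> i j _ _ [x [/= -> ->]].
rewrite -[A in LHS]image_id -bigcup_imset1 measure_fin_bigcup//.
rewrite fsbig_fintype -sumEFin; apply: eq_bigr => v _.
by rewrite fineK// fin_num_measure.
Qed.

End discrete_probability.

(* Product measure on sequences: the law of the digits of a uniform point of
   [0, 1[, digit n being read off by cutting the current interval in proportion
   to the weights w n. *)
Section sequence_measure.
Context (R : realType) (p : nat) (w : nat -> probability 'F_p R).

Let wt n (v : 'F_p) : R := fine (w n [set v]).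

Let wt_ge0 n v : 0 <= wt n v. Proof. exact: fine_ge0. Qed.

Let wt_sum n : \sum_v wt n v = 1.
Proof.
have /esym := probability_setT (w n); rewrite probability_atoms => -[->].
by apply: eq_bigl => v; rewrite in_setT.
Qed.

Let cdf n (v : 'F_p) := \sum_(u : 'F_p | (u < v)%N) wt n u.

Let cdf_step n (v v' : 'F_p) : (v < v')%N -> cdf n v + wt n v <= cdf n v'.
Proof.
move=> vv'; rewrite /cdf [leRHS](bigD1 v)//= [leLHS]addrC lerD2l.
rewrite [leRHS]big_mkcond [leLHS]big_mkcond/=; apply: ler_sum => u _.
case: ifPn => uv; last by case: ifP.
by rewrite (ltn_trans uv vv')/=; case: eqP uv => // ->; rewrite ltnn.
Qed.

Let cdf_ge0 n v : 0 <= cdf n v. Proof. exact: sumr_ge0. Qed.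

Let cdf_le1 n v : cdf n v + wt n v <= 1.
Proof.
rewrite -(wt_sum n) (bigD1 v)//= [leLHS]addrC lerD2l /cdf.
rewrite [leRHS]big_mkcond [leLHS]big_mkcond/=; apply: ler_sum => u _.
by case: ifPn => uv; case: ifPn => //; case: eqP uv => // ->; rewrite ltnn.
Qed.

Let bracket n v y := cdf n v <= y < cdf n v + wt n v.

Let bracket_ex n y : 0 <= y < 1 -> exists v, bracket n v y.
Proof.
move=> /andP[y0 y1].
have c0 : cdf n (ord0 : 'F_p) <= y by rewrite /cdf big_pred0.
case: (@arg_maxnP _ (ord0 : 'F_p) (fun v => cdf n v <= y) (fun v => v : nat) c0).
move=> v cv vmax; exists v; rewrite /bracket cv/= ltNge; apply/negP => le_y.
have [vlt|] := ltnP v.+1 (Zp_trunc (pdiv p)).+2.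
- have /vmax : cdf n (Ordinal vlt : 'F_p) <= y.
    apply: le_trans le_y; rewrite /cdf (bigD1 v)//= [leLHS]addrC lerD2r.
    rewrite le_eqVlt; apply/orP; left; apply/eqP; apply: eq_bigl => u.
    by rewrite ltnS [RHS]ltn_neqAle andbC.
  by rewrite /= ltnn.
- move=> vN.
  have : 1 <= y.
    apply: le_trans le_y; rewrite -(wt_sum n) (bigD1 v)//= [leLHS]addrC lerD2r.
    rewrite le_eqVlt; apply/orP; left; apply/eqP; apply: eq_bigl => u.
    rewrite ltn_neqAle andbC (_ : (u <= v)%N)//.
    by rewrite -ltnS; exact: leq_trans (ltn_ord u) vN.
  by rewrite leNgt y1.
Qed.

Let bracket_uniq n v v' y : bracket n v y -> bracket n v' y -> v = v'.
Proof.
move=> /andP[a b] /andP[c d]; apply: ord_inj; apply/eqP; rewrite eqn_leq.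
apply/andP; split; rewrite leqNgt; apply/negP => /(cdf_step n) e.
- by have := lt_le_trans (lt_le_trans d e) a; rewrite ltxx.
- by have := lt_le_trans (lt_le_trans b e) c; rewrite ltxx.
Qed.

Let cell n (s : R * R) v := (s.1 + s.2 * cdf n v, s.2 * wt n v).
Let inb (s : R * R) (o : R) := s.1 <= o < s.1 + s.2.

Let inb_cell n s v o : 0 < s.2 ->
  inb (cell n s v) o = bracket n v ((o - s.1) / s.2).
Proof.
move=> s0; rewrite /inb /bracket /cell/= ler_pdivlMr// ltr_pdivrMr//.
by congr andb; [rewrite lerBrDl mulrC|rewrite ltrBlDl mulrDl addrA ![_ * s.2]mulrC].
Qed.

Let dig n s o : 'F_p := odflt 0 [pick v | inb (cell n s v) o].

Fixpoint digit_state (o : R) (n : nat) : R * R :=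
  if n is m.+1 then cell m (digit_state o m) (dig m (digit_state o m) o)
  else (0, 1).

Let X o n := dig n (digit_state o n) o.

Fixpoint box (g : nat -> 'F_p) (n : nat) : R * R :=
  if n is m.+1 then cell m (box g m) (g m) else (0, 1).

Let state_box o n : digit_state o n = box (X o) n.
Proof. by elim: n => //= n IH; rewrite /X IH. Qed.

Let box_len g n : (box g n).2 = \prod_(i < n) wt i (g i).
Proof. by elim: n => [|n IH]; rewrite ?big_ord0// big_ord_recr/= IH. Qed.

Let box_len_ge0 g n : 0 <= (box g n).2.
Proof. by rewrite box_len; apply: prodr_ge0. Qed.

Let box_ext g h n : (forall i, (i < n)%N -> g i = h i) -> box g n = box h n.
Proof.
elim: n => //= n IH gh; rewrite IH ?gh// => i ilt; apply: gh; exact: ltnW.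
Qed.

Let inb_len s o : inb s o -> 0 < s.2.
Proof. by move=> /andP[a b]; move: (le_lt_trans a b); rewrite ltrDl. Qed.

Let inb_cellW n s v o : 0 <= s.2 -> inb (cell n s v) o -> inb s o.
Proof.
move=> s0 /andP[/= a b]; apply/andP; split.
  by apply: le_trans a; rewrite lerDl mulr_ge0.
apply: lt_le_trans b _; rewrite -addrA lerD2l -mulrDr.
by rewrite -[leRHS]mulr1 ler_wpM2l.
Qed.

Let inb_X o n : 0 <= o < 1 -> inb (box (X o) n) o.
Proof.
move=> o01; elim: n => [|n IH]; first by rewrite /inb/= add0r.
rewrite /= -state_box /X /dig; case: pickP => //= noc.
rewrite -state_box in IH; have s0 := inb_len IH.
have : 0 <= (o - (digit_state o n).1) / (digit_state o n).2 < 1.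
  case/andP: IH => a b.
  by rewrite divr_ge0 ?subr_ge0// ?ltW//= ltr_pdivrMr// mul1r ltrBlDl.
by case/(bracket_ex n) => v; rewrite -inb_cell// noc.
Qed.

Let X_inb g n o : inb (box g n) o -> forall i, (i < n)%N -> X o i = g i.
Proof.
elim: n => // n IH /= go i; rewrite ltnS leq_eqVlt.
have gn := inb_cellW (box_len_ge0 g n) go.
move=> /predU1P[->|]; last exact: IH.
have sE : digit_state o n = box g n by rewrite state_box; apply: box_ext; exact: IH.
rewrite /X sE /dig; case: pickP => /= [v|/(_ (g n))]; last by rewrite go.
rewrite !inb_cell ?(inb_len gn)// in go *.
by move=> /bracket_uniq; exact.
Qed.

Let Y (o : R) : conf nat p := if 0 <= o < 1 then X o else fun=> 0.

Let I01 : set R := `[0, 1[%classic.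

Let I01E o : I01 o = (0 <= o < 1) :> Prop.
Proof. by rewrite /I01 /= in_itv. Qed.

Let m01 : measurable (I01 : set (measurableTypeR R)).
Proof. exact: measurable_itv. Qed.

Let J g n : set (measurableTypeR R) :=
  `[(box g n).1, (box g n).1 + (box g n).2[%classic.

Let mJ g n : measurable (J g n). Proof. exact: measurable_itv. Qed.

Let Y_box g n : [set o | I01 o /\ forall i, (i < n)%N -> Y o i = g i] = J g n.
Proof.
apply/seteqP; split => o /=.
  rewrite /J /= in_itv/= I01E => -[ o01]; rewrite /Y o01; move=> Xg.
  by rewrite -(box_ext Xg); exact: inb_X.
rewrite /J /= in_itv/= => og.
have o01 : 0 <= o < 1.
  elim: n og => [|n IH]; first by rewrite /= add0r.
  by move=> /(inb_cellW (box_len_ge0 g n)).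
by rewrite I01E /Y o01; split => //; exact: X_inb.
Qed.

Let ext n (h : {ffun 'I_n -> 'F_p}) (i : nat) : 'F_p := oapp h 0 (insub i).

Let extE n (h : {ffun 'I_n -> 'F_p}) (i : 'I_n) : ext h i = h i.
Proof. by rewrite /ext valK. Qed.

Let Y_cells n (D : set {ffun 'I_n -> 'F_p}) :
  [set o | I01 o /\ D [ffun i : 'I_n => Y o i]] =
  \bigcup_(h in D) [set o | I01 o /\ forall i, (i < n)%N -> Y o i = ext h i].
Proof.
apply/seteqP; split => o /=.
  move=> [ o01 Do]; eexists; first exact: Do.
  by split=> // i ilt; rewrite (extE _ (Ordinal ilt)) ffunE.
move=> [h Dh [ o01 oh]]; split => //.
rewrite (_ : finfun _ = h)//; apply/ffunP => i.
by rewrite ffunE oh// extE.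
Qed.

Let measurable_Y : measurable_fun setT (Y : measurableTypeR R -> conf nat p).
Proof.
apply: measurable_conf => i v.
rewrite (_ : [set _ | _] =
  [set o | I01 o /\ [set h : {ffun 'I_i.+1 -> 'F_p} | h ord_max = v]
                      [ffun j : 'I_i.+1 => Y o j]] `|`
  (~` I01 `&` [set o | v = 0])); last first.
  apply/seteqP; split => o /=; rewrite I01E ffunE.
    have [ o01|o01] := boolP (0 <= o < 1); first by left.
    by rewrite /Y (negbTE o01) => <-; right.
  case=> [[_]//|[/negP/negbTE o01 /= ->]].
    by rewrite /Y o01.
apply: measurableU.
  rewrite Y_cells; apply: fin_bigcup_measurable; first exact: finite_finset.
  by move=> h _; rewrite Y_box; exact: mJ.
apply: measurableI; first by apply: measurableC; exact: m01.
have [->|v0] := eqVneq v 0; first by rewrite (_ : [set _ | _] = setT)//; apply/seteqP.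
rewrite (_ : [set _ | _] = set0)//; apply/seteqP; split=> // x /=.
by move/eqP: v0.
Qed.

Let Y_law : set (conf nat p) -> \bar R :=
  pushforward (mrestr (@lebesgue_measure R) m01) Y.

Let Y_law0 : Y_law set0 = 0%E.
Proof. by rewrite /Y_law /pushforward preimage_set0 measure0. Qed.

Let Y_law_ge0 A : (0 <= Y_law A)%E. Proof. exact: measure_ge0. Qed.

Let Y_law_additive : semi_sigma_additive Y_law.
Proof.
exact: (@measure_semi_sigma_additive _ _ _
  (pushforward (mrestr (@lebesgue_measure R) m01) Y)).
Qed.

HB.instance Definition _ :=
  isMeasure.Build _ _ _ Y_law Y_law0 Y_law_ge0 Y_law_additive.

Let Y_lawT : Y_law setT = 1%E.
Proof.
rewrite /Y_law /pushforward preimage_setT /mrestr setTI lebesgue_measure_itv/=.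
by rewrite lte_fin ltr01 -EFinB subr0.
Qed.

HB.instance Definition _ := Measure_isProbability.Build _ _ _ Y_law Y_lawT.

Let Y_lawE n (A : nat -> set 'F_p) :
  Y_law [set x | forall i, (i < n)%N -> A i (x i)] = (\prod_(i < n) w i (A i))%E.
Proof.
pose D : set {ffun 'I_n -> 'F_p} := [set h | forall i : 'I_n, A i (h i)].
rewrite /Y_law /pushforward /mrestr.
rewrite (_ : _ `&` _ = [set o | I01 o /\ D [ffun i : 'I_n => Y o i]]); last first.
  apply/seteqP; split => o /=.
    by move=> [AY o01]; split=> // i; rewrite ffunE; exact: AY.
  move=> [ o01 Do]; split => // i ilt.
  by have := Do (Ordinal ilt); rewrite ffunE.
rewrite Y_cells measure_fin_bigcup/=; last 3 first.
- exact: finite_finset.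
- move=> h h' _ _ [ o [/= [_ oh] [_ oh']]]; apply/ffunP => i.
  by rewrite -!extE -oh// oh'.
- by move=> h _; rewrite Y_box; exact: mJ.
rewrite fsbig_fintype.
rewrite (eq_bigr (fun h : {ffun 'I_n -> 'F_p} => (\prod_(i < n) wt i (h i))%:E)); last first.
  move=> h _; rewrite Y_box /J lebesgue_measure_itv/= lte_fin ltrDl.
  rewrite lt_neqAle box_len_ge0 andbT -EFinB addrAC subrr add0r box_len.
  under [in RHS]eq_bigr do rewrite -extE.
  by case: eqP => // <-.
rewrite sumEFin (eq_bigr (fun i : 'I_n => (\sum_(v in A i) wt i v)%:E)); last first.
  by move=> i _; rewrite probability_atoms.
rewrite prodEFin bigA_distr_big_dep/=; congr EFin; apply: eq_bigl => h.
apply/idP/familyP => [/set_mem Dh i|Dh]; first by apply: mem_set; exact: Dh.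
by apply: mem_set => i; exact: set_mem (Dh i).
Qed.

Lemma sequence_measure_exists : exists mu : probability (conf nat p) R,
  forall n (A : nat -> set 'F_p),
  mu [set x | forall i, (i < n)%N -> A i (x i)] = (\prod_(i < n) w i (A i))%E.
Proof. by exists Y_law; exact: Y_lawE. Qed.

End sequence_measure.

Definition is_product_measure (R : realType) (I : choiceType) (p : nat)
    (alpha : I -> probability 'F_p R) (mu : set (conf I p) -> \bar R) :=
  forall (J : seq I) (A : I -> set 'F_p), uniq J ->
  mu [set x | forall i, i \in J -> A i (x i)] = (\prod_(i <- J) alpha i (A i))%E.

Lemma product_measure_exists (R : realType) (I : countType) (p : nat)
    (alpha : I -> probability 'F_p R) :
  exists mu : probability (conf I p) R, is_product_measure alpha mu.
Proof.
pose w n := oapp alpha (dirac (0 : 'F_p) : probability _ _) (pickle_inv n : option I).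
have [nu nuE] := sequence_measure_exists w.
pose f (x : conf nat p) : conf I p := fun i => x (pickle i).
have mf : measurable_fun setT f.
  by apply: (@measurable_finitary _ _ _ _ (fun i => [:: pickle i])) => i x y; apply; rewrite inE.
pose fX : {mfun conf nat p >-> conf I p} := HB.pack f (isMeasurableFun.Build _ _ _ _ f mf).
exists (distribution nu fX) => J A uJ.
pose n := \max_(i <- J) (pickle i).+1.
have ltn i : i \in J -> (pickle i < n)%N.
  by move=> iJ; rewrite /n; exact: (@leq_bigmax_seq _ _ _ (fun i => (pickle i).+1)).
pose B k : set 'F_p := oapp (fun i : I => if i \in J then A i else setT) setT (pickle_inv k).
transitivity (nu [set x | forall k, (k < n)%N -> B k (x k)]).
  rewrite /distribution /pushforward; congr (nu _); apply/seteqP; split => x /=.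
    move=> Ax k _; rewrite /B.
    case E : (pickle_inv k) => [i|]//=; case: ifPn => // iJ.
    by have := @pickle_invK I k; rewrite E/= => <-; exact: Ax.
  by move=> Bx i iJ; have := Bx _ (ltn i iJ); rewrite /B pickleK_inv/= iJ.
rewrite nuE -(big_mkord xpredT (fun k => w k (B k))).
rewrite (bigID (fun k => k \in map pickle J))/= [X in (_ * X)%E]big1 ?mule1; last first.
  move=> k kJ; rewrite /w /B; case E : (pickle_inv k) => [i|]/=; last exact: probability_setT.
  case: ifPn => [iJ|_]; last exact: probability_setT.
  have := @pickle_invK I k; rewrite E/= => kE.
  by move: kJ; rewrite -kE map_f.
rewrite -big_filter (perm_big (map pickle J)); last first.
  apply: uniq_perm; first by rewrite filter_uniq// iota_uniq.
    by rewrite map_inj_uniq//; exact: (pcan_inj pickleK).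
  move=> k; rewrite mem_filter mem_index_iota/=.
  by case: mapP => //= -[i iJ ->]; exact: ltn.
rewrite big_map big_seq [RHS]big_seq; apply: eq_bigr => i iJ.
by rewrite /w /B pickleK_inv/= iJ.
Qed.

Definition product_measure (R : realType) (I : countType) (p : nat)
    (alpha : I -> probability 'F_p R) : probability (conf I p) R :=
  sval (cid (product_measure_exists alpha)).

Lemma product_measureP (R : realType) (I : countType) (p : nat)
    (alpha : I -> probability 'F_p R) :
  is_product_measure alpha (product_measure alpha).
Proof. by rewrite /product_measure; case: cid. Qed.

Section uniform.
Context (R : realType) (p : nat).

Definition uniform_Fp : set 'F_p -> \bar R :=
  mscale (#|'F_p|%:R^-1)%:nng counting.

HB.instance Definition _ := Measure.on uniform_Fp.

Let uniform_FpT : uniform_Fp setT = 1%E.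
Proof.
rewrite /uniform_Fp /mscale/= /counting; case: ifPn => [|/negP[]]; last first.
  exact/mem_set/finite_finset.
move=> _; rewrite (_ : size _ = #|'F_p|); last first.
  rewrite cardE; apply/perm_size/uniq_perm; rewrite ?enum_uniq//.
  by move=> v; rewrite mem_enum/= in_fset_set ?in_setT//; exact: finite_finset.
by rewrite -EFinM mulVf// pnatr_eq0 card_ord.
Qed.

HB.instance Definition _ := Measure_isProbability.Build _ _ _ uniform_Fp uniform_FpT.

Lemma uniform_Fp1 (r : 'F_p) : prime p -> uniform_Fp [set r] = (p%:R^-1)%:E.
Proof.
move=> pp; rewrite /uniform_Fp /mscale/= /counting asboolT//.
by rewrite fset_set1 finmap.cardfs1 mule1 card_Fp.
Qed.

End uniform.
Arguments uniform_Fp : clear implicits.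

(* Index set {(k, n) | k < n} of the strictly upper triangular part of a matrix
   with rows k : K, where r k is the number of row k; rows and columns are
   numbered from 0. K = 'I_m gives the first m rows, K = nat all rows. *)
Definition idx (K : countType) (r : K -> nat) :=
  {kn : K * nat | (r kn.1 < kn.2)%N}.

Definition Xm (m p : nat) := conf (idx (@nat_of_ord m)) p.
Definition BN (p : nat) := conf (idx (@id nat)) p.

Definition rowidx (k : nat) := {n : nat | (k < n)%N}.

HB.instance Definition _ K r := Countable.on (@idx K r).
HB.instance Definition _ k := Countable.on (rowidx k).

Definition mu_inv (R : realType) (p k : nat) : probability (conf (rowidx k) p) R :=
  product_measure (fun _ : rowidx k => uniform_Fp R p : probability 'F_p R).

Section matrices.
Context (K : countType) (r : K -> nat) (p : nat).
Implicit Types (x y : conf (idx r) p) (s t : BN p).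

(* All entries of the matrix, units on the diagonal and zeros below included. *)
Definition entry x (k : K) (n : nat) : 'F_p :=
  oapp x (r k == n)%:R (insub (k, n)).

Lemma entry_idx x (i : idx r) : entry x (val i).1 (val i).2 = x i.
Proof. by rewrite /entry -surjective_pairing valK. Qed.

Lemma entry_diag x k n : (n <= r k)%N -> entry x k n = (r k == n)%:R.
Proof. by move=> nk; rewrite /entry insubF//=; rewrite ltnNge nk. Qed.

Lemma entryP x y : (forall k n, entry x k n = entry y k n) -> x = y.
Proof. by move=> xy; apply/funext => i; rewrite -!entry_idx xy. Qed.

End matrices.

Section right_multiplication.
Context (K : countType) (r : K -> nat) (p : nat).
Implicit Types (x : conf (idx r) p) (s t : BN p).

(* Matrix product: t has no entry (j, n) with n < j. *)
Definition mulB x t : conf (idx r) p := fun i =>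
  \sum_(j < (val i).2.+1) entry x (val i).1 j * entry t j (val i).2.

Lemma entry_mulB x t k n N : (n <= N)%N ->
  entry (mulB x t) k n = \sum_(j < N.+1) entry x k j * entry t j n.
Proof.
move=> nN; rewrite (_ : \sum_(j < N.+1) _ = \sum_(j < n.+1) entry x k j * entry t j n).
  have [kn|nk] := ltnP (r k) n.
    by rewrite [LHS]/entry insubT.
  rewrite entry_diag//; case: ltngtP nk => // [nk|kn] _.
    rewrite big1// => -[j/= jn] _; rewrite entry_diag//; last exact: leq_trans (ltnW nk).
    by rewrite gtn_eqF ?mul0r//; exact: leq_trans jn nk.
  rewrite big_ord_recr/= big1 => [|[j/= jn] _].
    by rewrite !entry_diag ?kn// eqxx mul1r add0r.
  by rewrite (entry_diag x) -?kn ?gtn_eqF ?mul0r// ltnW.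
rewrite -(big_mkord xpredT (fun j => entry x k j * entry t j n)).
rewrite -[RHS](big_mkord xpredT (fun j => entry x k j * entry t j n)).
rewrite (@big_cat_nat _ _ _ n.+1)//= [X in _ + X]big_nat [X in _ + X]big1 ?addr0// => j.
by move=> /andP[nj _]; rewrite (entry_diag t) ?(ltnW nj)//= gtn_eqF ?mulr0.
Qed.

Lemma measurable_mulB t : measurable_fun setT (mulB ^~ t).
Proof.
pose D (i : idx r) : seq (idx r) :=
  pmap insub [seq ((val i).1, j) | j <- iota 0 (val i).2.+1].
apply: (@measurable_finitary _ _ _ _ D) => i x y xy; apply: eq_bigr => j _.
congr (_ * _); rewrite /entry; case: insubP => //= u _ uE; apply: xy.
rewrite mem_pmap; apply/mapP; exists (sval u); last by rewrite valK.
rewrite uE; apply/mapP; exists (j : nat) => //.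
by rewrite mem_iota/= add0n ltn_ord.
Qed.

End right_multiplication.

Section group_laws.
Context (p : nat).

Definition oneB : BN p := fun=> 0.

Lemma entry_oneB k n : entry oneB k n = (k == n)%:R.
Proof.
rewrite /entry; case: insubP => //= -[[k' n'] /= kn] _ [<- <-].
by rewrite ltn_eqF.
Qed.

Definition leading (t : BN p) n : 'M['F_p]_n.+1 := \matrix_(i, j) entry t i j.

(* Column n of the inverse is that of the inverse of the leading block of
   size n + 1. *)
Definition invB (t : BN p) : BN p := fun i =>
  invmx (leading t (val i).2) (inord (val i).1) ord_max.

Lemma leading_unit t n : leading t n \in unitmx.
Proof.
rewrite unitmxE -det_tr det_trig.
  by rewrite big1 ?unitr1// => i _; rewrite !mxE entry_diag// eqxx.
apply/is_trig_mxP => i j ij; rewrite !mxE entry_diag; last exact: ltnW.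
by rewrite (gtn_eqF ij).
Qed.

Lemma entry_invB t k n : (k <= n)%N ->
  entry (invB t) k n = invmx (leading t n) (inord k) ord_max.
Proof.
rewrite leq_eqVlt => /predU1P[->|kn]; last by rewrite [LHS]/entry insubT.
rewrite entry_diag// eqxx (_ : inord n = ord_max); last first.
  by apply: val_inj; rewrite /= inordK.
have /matrixP/(_ ord_max ord_max) := mulmxV (leading_unit t n).
rewrite !mxE eqxx big_ord_recr/= big1 => [|i _].
  by rewrite add0r mxE entry_diag// eqxx mul1r.
by rewrite mxE entry_diag/= ?gtn_eqF ?mul0r// ltnW.
Qed.

Lemma mulBV t : mulB t (invB t) = oneB.
Proof.
apply: entryP => k n; rewrite (entry_mulB _ _ _ (leqnn n)) entry_oneB.
have [kn|nk] := leqP k n; last first.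
  rewrite gtn_eqF// big1// => -[j/= jn] _; rewrite entry_diag/=.
    by rewrite gtn_eqF ?mul0r//; exact: leq_trans jn _.
  by apply: ltnW; exact: leq_trans jn _.
have /matrixP/(_ (inord k) ord_max) := mulmxV (leading_unit t n).
rewrite !mxE -val_eqE/= inordK// => <-; apply: eq_bigr => j _.
have jn : (j <= n)%N by rewrite -ltnS.
by rewrite !mxE inordK// entry_invB// inord_val.
Qed.

Lemma mulBA (K : countType) (r : K -> nat) (x : conf (idx r) p) (s t : BN p) :
  mulB (mulB x s) t = mulB x (mulB s t).
Proof.
apply: entryP => k n; rewrite !(entry_mulB _ _ _ (leqnn n)).
transitivity (\sum_(j < n.+1) \sum_(i < n.+1) entry x k i * entry s i j * entry t j n).
  apply: eq_bigr => j _.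
  have jn : (j <= n)%N by rewrite -ltnS.
  by rewrite (entry_mulB _ _ _ jn) mulr_suml.
rewrite exchange_big; apply: eq_bigr => i _.
rewrite (entry_mulB _ _ _ (leqnn n)) mulr_sumr.
by apply: eq_bigr => j _; rewrite mulrA.
Qed.

Lemma mulB1 (K : countType) (r : K -> nat) (x : conf (idx r) p) : mulB x oneB = x.
Proof.
apply: entryP => k n; rewrite (entry_mulB _ _ _ (leqnn n)).
rewrite (bigD1 ord_max)//= entry_oneB eqxx mulr1 big1 ?addr0// => j.
by rewrite -val_eqE/= entry_oneB => /negbTE ->; rewrite mulr0.
Qed.

Lemma mulVB t : mulB (invB t) t = oneB.
Proof.
pose s := invB t.
have st_s : mulB (mulB s t) s = s by rewrite mulBA mulBV mulB1.
by rewrite -[LHS]mulB1 -(mulBV s) -mulBA st_s mulBV.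
Qed.

Definition B0 : set (BN p) := [set t | finite_set [set i | t i != 0]].

End group_laws.

Section right_action.
Context (K : countType) (r : K -> nat) (p : nat).
Implicit Types (x : conf (idx r) p) (t : BN p).

Definition actR t x : conf (idx r) p := mulB x (invB t).

Definition actRV t x : conf (idx r) p := mulB x t.

Lemma actRK t : cancel (actR t) (actRV t).
Proof. by move=> x; rewrite /actRV mulBA mulVB mulB1. Qed.

Lemma actRVK t : cancel (actRV t) (actR t).
Proof. by move=> x; rewrite /actR mulBA mulBV mulB1. Qed.

Lemma measurable_actR t : measurable_fun setT (actR t).
Proof. exact: measurable_mulB. Qed.

HB.instance Definition _ t :=
  isMeasurableFun.Build _ _ _ _ (actR t) (measurable_actR t).

End right_action.

(* B(m, F_p), units on the diagonal meaning ones. *)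
Definition unitriangular (p m : nat) (t : 'M['F_p]_m) :=
  forall i j : 'I_m, (j <= i)%N -> t i j = (i == j)%:R.

Definition actLX (p m : nat) (t : 'M['F_p]_m) (x : Xm m p) : Xm m p := fun i =>
  \sum_(j < m) t (val i).1 j * entry x j (val i).2.

Lemma entry_actLX (p m : nat) (t : 'M['F_p]_m) (x : Xm m p) k n :
  unitriangular t -> entry (actLX t x) k n = \sum_(j < m) t k j * entry x j n.
Proof.
move=> tU; have [kn|nk] := ltnP k n; first by rewrite [LHS]/entry insubT.
rewrite entry_diag// (bigD1 k)//= tU// eqxx mul1r entry_diag//.
rewrite big1 ?addr0// => j jk; have [jlt|] := ltnP k j; last first.
  by move=> jk'; rewrite tU// eq_sym (negbTE jk) mul0r.
rewrite entry_diag ?gtn_eqF ?mulr0//; first exact: leq_ltn_trans jlt.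
by apply: ltnW; exact: leq_ltn_trans jlt.
Qed.

Definition actLB (p : nat) (t x : BN p) : BN p := mulB t x.

Section L2.
Context d (T : measurableType d) (R : realType) (mu : probability T R).
Implicit Types f g : T -> R[i].

Definition cmeasurable f :=
  measurable_fun setT (fun x => complex.Re (f x)) /\
  measurable_fun setT (fun x => complex.Im (f x)).

Definition sqnorm f : \bar R :=
  (\int[mu]_x (complex.Re (f x) ^+ 2 + complex.Im (f x) ^+ 2)%:E)%E.

Definition inL2 f := cmeasurable f /\ (sqnorm f < +oo)%E.

Definition inL1 f :=
  mu.-integrable setT (fun x => (complex.Re (f x))%:E) /\
  mu.-integrable setT (fun x => (complex.Im (f x))%:E).

(* Closed subspaces of L^2(T, mu; C), as sets of representatives. The last
   clause makes them saturated for equality mu-a.e. *)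
Record closed_subspace (V : set (T -> R[i])) : Prop := ClosedSubspace {
  closed_subspace_L2 : V `<=` inL2 ;
  closed_subspace0 : V (fun=> 0) ;
  closed_subspaceD : forall f g, V f -> V g -> V (fun x => f x + g x) ;
  closed_subspaceZ : forall (c : R[i]) f, V f -> V (fun x => c * f x) ;
  closed_subspace_closed : forall f, inL2 f ->
    (forall e : R, 0 < e -> exists2 g, V g & (sqnorm (fun x => (f x - g x)%R) < e%:E)%E) ->
    V f
}.

(* The operators U t, t in D, have no closed invariant subspace other than 0
   and L^2; L^2 is not 0 as mu is a probability. *)
Definition irreducible (G : Type) (D : set G) (U : G -> (T -> R[i]) -> (T -> R[i])) :=
  forall V, closed_subspace V -> (forall t f, D t -> V f -> V (U t f)) ->
  (forall f, V f -> {ae mu, forall x, f x = 0}) \/ V = inL2.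

Definition ergodic (G : Type) (D : set G) (act : G -> T -> T) :=
  forall f, inL1 f -> (forall t, D t -> {ae mu, forall x, f (act t x) = f x}) ->
  exists c : R[i], {ae mu, forall x, f x = c}.

Definition mutually_singular (mu1 mu2 : set T -> \bar R) :=
  exists N, [/\ measurable N, mu1 N = 0%E & mu2 (~` N) = 0%E].

End L2.

Local Open Scope charge_scope.

(* With image measures mu^f = pushforward mu f, the derivative
   d mu (R_t^-1 x) / d mu x is that of mu^(R_t) with respect to mu. *)
Definition repR (R : realType) (K : countType) (r : K -> nat) (p : nat)
    (mu : probability (conf (idx r) p) R) (t : BN p)
    (f : conf (idx r) p -> R[i]) (x : conf (idx r) p) : R[i] :=
  let rho := 'd (charge_of_finite_measure (distribution mu (actR t))) '/d mu in
  (Num.sqrt (fine (rho x)))%:C%C * f (actRV t x).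

(* Main.v *)
(* Suppose that M is a probability for which mu << M, and that H is a set of
   measurable bijections preserving M and the null sets of mu, and normalized by
   the right action. Multiplication by (d mu / d M)^(1/2) embeds L^2(mu) into
   L^2(M) and intertwines the two representations, and the f in L^2(mu) mapped
   to H-invariant functions form an invariant closed subspace. It contains
   (d mu / d M)^(-1/2), so if the representation is irreducible then every h in H
   is trivial mod mu.
   Irreducibility also makes every invariant set null or conull, since the
   functions supported by such a set are an invariant subspace. This gives
   ergodicity, and for every quasi-invariant probability nu: either nu and mu are
   mutually singular or mu << nu.
   If mu^(L_t) is not singular to mu then all the mu^(L_t^j) are equivalent to mu,
   because t has finite order; take for M their average and H = {L_t}.
   If row k of mu is not singular to the uniform row then mu is not singular to
   the measure M in which row k is made uniform; take for H the translations of
   row k that preserve the null sets of mu. *)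
Require Import Defs.
From HB Require Import structures.
From mathcomp Require Import all_boot all_order all_algebra complex.
From mathcomp Require Import all_classical all_reals all_analysis measurable_realfun.
From mathcomp Require Import ring lra.
Import Order.TTheory GRing.Theory Num.Theory.
Local Open Scope classical_set_scope.
Local Open Scope ring_scope.
Import numFieldNormedType.Exports.

Set Implicit Arguments.
Unset Strict Implicit.
Unset Printing Implicit Defensive.

(** * Square roots of densities *)

Section measure_lemmas.
Context (R : realType).

(* w is the square root of the density with respect to M of the image of mu
   under a. *)
Definition sqrt_density d1 d2 (T1 : measurableType d1) (T2 : measurableType d2)
    (mu : probability T1 R) (M : probability T2 R) (a : T1 -> T2) (w : T2 -> R) :=
  [/\ measurable_fun setT w, (forall x, 0 <= w x) &
   forall f : T2 -> \bar R, measurable_fun setT f -> (forall x, 0 <= f x)%E ->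
   (\int[mu]_x f (a x) = \int[M]_x (f x * (w x ^+ 2)%:E))%E].

(** With [a := id] this is absolute continuity of [mu] with respect to [M]; with [M := mu] it says
    that preimages under [a] preserve null sets, one half of quasi-invariance. *)
Definition nonsingular d1 d2 (T1 : measurableType d1) (T2 : measurableType d2)
    (mu : probability T1 R) (M : probability T2 R) (a : T1 -> T2) :=
  forall A, measurable A -> M A = 0%E -> mu (a @^-1` A) = 0%E.

Context d1 d2 (T1 : measurableType d1) (T2 : measurableType d2).
Context (mu : probability T1 R) (M : probability T2 R).

Lemma measurable_preim (a : T1 -> T2) A : measurable_fun setT a ->
  measurable A -> measurable (a @^-1` A).
Proof. by move=> ma mA; rewrite -[X in measurable X]setTI; exact: ma. Qed.

Lemma dominates_distribution (a : {mfun T1 >-> T2}) :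
  nonsingular mu M a -> distribution mu a `<< M.
Proof.
move=> ns A nA B mB BA; apply: ns => //; exact: nA.
Qed.

(** The weight is literally the one in [repR], so the abstract results below apply to that
    operator. *)
Lemma sqrt_density_RN (a : {mfun T1 >-> T2}) : nonsingular mu M a ->
  sqrt_density mu M a (fun x => Num.sqrt (fine
    (Radon_Nikodym (charge_of_finite_measure (distribution mu a)) M x))).
Proof.
move=> /dominates_distribution ns.
set g := Radon_Nikodym _ _.
have mg : measurable_fun setT g.
  by apply: measurable_int; exact: Radon_Nikodym_integrable.
have mw : measurable_fun setT (fun x => Num.sqrt (fine (g x))).
  apply: (measurableT_comp (continuous_measurable_fun (@sqrt_continuous R))).
  exact: measurableT_comp.
split=> // f mf f0.
rewrite -(ge0_integral_distribution _ mf f0).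
(* The change of variables holds for the derivative of the sigma-finite theory, which is finite and
   nonnegative and agrees a.e. with [g]; hence [fine] and the square root lose nothing a.e. *)
rewrite -(Radon_Nikodym_SigmaFinite.change_of_variables ns)//.
have /= ae := ae_eq_Radon_Nikodym_SigmaFinite ns measurableT.
have mrn : measurable_fun setT (Radon_Nikodym_SigmaFinite.f (distribution mu a) M).
  by apply: measurable_int; exact: Radon_Nikodym_SigmaFinite.f_integrable.
apply: ge0_ae_eq_integral => //.
- exact: emeasurable_funM.
- apply: emeasurable_funM => //; apply/measurable_EFinP.
  exact: (measurable_funX 2 mw).
- by move=> x _; rewrite mule_ge0// Radon_Nikodym_SigmaFinite.f_ge0.
- by move=> x _; rewrite mule_ge0// lee_fin sqr_ge0.
- apply: filterS ae => x /(_ I) e _.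
  have := Radon_Nikodym_SigmaFinite.f_ge0 ns x.
  have := Radon_Nikodym_SigmaFinite.f_fin_num ns x.
  rewrite e -/g => fg g0; congr (_ * _)%E.
  by rewrite sqr_sqrtr ?fineK// fine_ge0.
Qed.

End measure_lemmas.

(** * Closed subspaces of L^2 *)

Section complex_L2.
Context (R : realType).

(** The squared modulus, spelled as in [sqnorm] so that [sqnormE] holds by conversion. *)
Definition nrm2 (z : R[i]) : R := complex.Re z ^+ 2 + complex.Im z ^+ 2.

Lemma nrm2_ge0 z : 0 <= nrm2 z.
Proof. by rewrite addr_ge0// sqr_ge0. Qed.

Lemma nrm2M z z' : nrm2 (z * z') = nrm2 z * nrm2 z'.
Proof. case: z z' => [a b] [c d]; rewrite /nrm2 /=; ring. Qed.

Lemma nrm2_real (r : R) : nrm2 (r%:C)%C = r ^+ 2.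
Proof. by rewrite /nrm2 /= expr0n addr0. Qed.

Lemma nrm2N z : nrm2 (- z) = nrm2 z.
Proof. by case: z => [a b]; rewrite /nrm2 /= !sqrrN. Qed.

Lemma nrm2D z z' : nrm2 (z + z') <= 2 * nrm2 z + 2 * nrm2 z'.
Proof.
case: z z' => [a b] [c d]; rewrite /nrm2 /=.
have := sqr_ge0 (a - c); have := sqr_ge0 (b - d); nra.
Qed.

Lemma nrm2_eq0 z : nrm2 z = 0 -> z = 0.
Proof.
case: z => [a b] /eqP; rewrite /nrm2 /= paddr_eq0 ?sqr_ge0// !sqrf_eq0.
by move=> /andP[/eqP-> /eqP->].
Qed.

Section cmeasurable.
Context d (T : measurableType d).
Implicit Types f g : T -> R[i].

Lemma cmeasurable_cst (c : R[i]) : cmeasurable (fun _ : T => c).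
Proof. by split; exact: measurable_cst. Qed.

Lemma cmeasurable_real (u : T -> R) : measurable_fun setT u ->
  cmeasurable (fun x => (u x)%:C%C).
Proof. by move=> mu; split => //=; exact: measurable_cst. Qed.

Lemma cmeasurableD f g : cmeasurable f -> cmeasurable g ->
  cmeasurable (fun x => f x + g x).
Proof.
move=> [mf1 mf2] [mg1 mg2]; split.
- rewrite (_ : (fun _ => _) = (fun x => complex.Re (f x) + complex.Re (g x))).
    exact: measurable_funD.
  by apply/funext => x; rewrite raddfD.
- rewrite (_ : (fun _ => _) = (fun x => complex.Im (f x) + complex.Im (g x))).
    exact: measurable_funD.
  by apply/funext => x; rewrite raddfD.
Qed.

Lemma cmeasurableM f g : cmeasurable f -> cmeasurable g ->
  cmeasurable (fun x => f x * g x).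
Proof.
move=> [mf1 mf2] [mg1 mg2]; split.
- rewrite (_ : (fun _ => _) = (fun x => complex.Re (f x) * complex.Re (g x)
      - complex.Im (f x) * complex.Im (g x))).
    by apply: measurable_funB; exact: measurable_funM.
  by apply/funext => x; case: (f x) => ? ?; case: (g x).
- rewrite (_ : (fun _ => _) = (fun x => complex.Re (f x) * complex.Im (g x)
      + complex.Im (f x) * complex.Re (g x))).
    by apply: measurable_funD; exact: measurable_funM.
  by apply/funext => x; case: (f x) => ? ?; case: (g x).
Qed.

Lemma cmeasurableN f : cmeasurable f -> cmeasurable (fun x => - f x).
Proof.
rewrite (_ : (fun x => - f x) = (fun x => -1 * f x)).
  by apply: cmeasurableM; exact: cmeasurable_cst.
by apply/funext => x; rewrite mulN1r.
Qed.

Lemma cmeasurable_comp d' (T' : measurableType d') (h : T' -> T) f :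
  measurable_fun setT h -> cmeasurable f -> cmeasurable (fun x => f (h x)).
Proof.
by move=> mh [mr mi]; split; [exact: (measurableT_comp mr mh)|exact: (measurableT_comp mi mh)].
Qed.

Lemma measurable_nrm2 f : cmeasurable f ->
  measurable_fun setT (fun x => nrm2 (f x)).
Proof.
move=> [mr mi]; exact: (measurable_funD (measurable_funX 2 mr) (measurable_funX 2 mi)).
Qed.

Lemma emeasurable_nrm2 f : cmeasurable f ->
  measurable_fun setT (fun x => (nrm2 (f x))%:E).
Proof. by move=> ?; apply/measurable_EFinP; exact: measurable_nrm2. Qed.

End cmeasurable.

Section sqnorm.
Context d (T : measurableType d) (mu : probability T R).
Implicit Types f g : T -> R[i].

Lemma sqnormE f : sqnorm mu f = (\int[mu]_x (nrm2 (f x))%:E)%E.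
Proof. by []. Qed.

Lemma sqnorm_ge0 f : (0 <= sqnorm mu f)%E.
Proof. by apply: integral_ge0 => x _; rewrite lee_fin nrm2_ge0. Qed.

Lemma sqnorm_eq0 f : cmeasurable f -> sqnorm mu f = 0%E ->
  {ae mu, forall x, f x = 0}.
Proof.
move=> mf f0.
have : (\int[mu]_x `|(nrm2 (f x))%:E|)%E = 0%E.
  rewrite -f0 sqnormE; apply: eq_integral => x _.
  by rewrite gee0_abs// lee_fin nrm2_ge0.
move/(ae_eq_integral_abs mu measurableT (emeasurable_nrm2 mf)).
by apply: filterS => x /(_ I)[/nrm2_eq0].
Qed.

Lemma sqnormM (c : R[i]) f : cmeasurable f ->
  sqnorm mu (fun x => c * f x) = ((nrm2 c)%:E * sqnorm mu f)%E.
Proof.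
move=> mf; rewrite !sqnormE -ge0_integralZl//.
- by apply: eq_integral => x _; rewrite nrm2M EFinM.
- exact: emeasurable_nrm2.
- by move=> x _; rewrite lee_fin nrm2_ge0.
- by rewrite lee_fin nrm2_ge0.
Qed.

Lemma le_sqnorm f g : cmeasurable f -> cmeasurable g ->
  (forall x, nrm2 (f x) <= nrm2 (g x)) -> (sqnorm mu f <= sqnorm mu g)%E.
Proof.
move=> mf mg fg; apply: ge0_le_integral => //.
- by move=> x _; rewrite lee_fin nrm2_ge0.
- exact: emeasurable_nrm2.
- exact: emeasurable_nrm2.
- by move=> x _; rewrite lee_fin; exact: fg.
Qed.

Lemma sqnormD f g : cmeasurable f -> cmeasurable g ->
  (sqnorm mu (fun x => (f x + g x)%R) <= 2%:E * sqnorm mu f + 2%:E * sqnorm mu g)%E.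
Proof.
move=> mf mg; rewrite !sqnormE.
rewrite -ge0_integralZl//; last 2 first.
- exact: emeasurable_nrm2.
- by move=> x _; rewrite lee_fin nrm2_ge0.
rewrite -ge0_integralZl//; last 2 first.
- exact: emeasurable_nrm2.
- by move=> x _; rewrite lee_fin nrm2_ge0.
have m2 h : cmeasurable h -> measurable_fun setT (fun x : T => 2%:E * (nrm2 (h x))%:E)%E.
  by move=> mh; apply: measurable_funeM; exact: emeasurable_nrm2.
rewrite -ge0_integralD//; last 4 first.
- by move=> x _; rewrite -EFinM lee_fin mulr_ge0// nrm2_ge0.
- exact: m2.
- by move=> x _; rewrite -EFinM lee_fin mulr_ge0// nrm2_ge0.
- exact: m2.
apply: ge0_le_integral => //.
- by move=> x _; rewrite lee_fin nrm2_ge0.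
- by apply: emeasurable_nrm2; exact: cmeasurableD.
- by apply: emeasurable_funD; exact: m2.
- by move=> x _; rewrite -!EFinM -EFinD lee_fin nrm2D.
Qed.

Lemma ae_eq_sqnorm f g : cmeasurable f -> cmeasurable g ->
  {ae mu, forall x, f x = g x} -> sqnorm mu f = sqnorm mu g.
Proof.
move=> mf mg fg; apply: ge0_ae_eq_integral => //.
- exact: emeasurable_nrm2.
- exact: emeasurable_nrm2.
- by move=> x _; rewrite lee_fin nrm2_ge0.
- by move=> x _; rewrite lee_fin nrm2_ge0.
- by apply: filterS fg => x -> _.
Qed.

Lemma inL2D f g : inL2 mu f -> inL2 mu g -> inL2 mu (fun x => f x + g x).
Proof.
move=> [mf f2] [mg g2]; split; first exact: cmeasurableD.
apply: le_lt_trans (sqnormD mf mg) _.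
by apply: lte_add_pinfty; apply: lte_mul_pinfty.
Qed.

Lemma inL2Z c f : inL2 mu f -> inL2 mu (fun x => c * f x).
Proof.
move=> [mf f2]; split; first by apply: cmeasurableM => //; exact: cmeasurable_cst.
by rewrite sqnormM//; apply: lte_mul_pinfty => //; rewrite lee_fin nrm2_ge0.
Qed.

Lemma inL20 : inL2 mu (fun=> 0).
Proof.
split; first exact: cmeasurable_cst.
rewrite sqnormE (eq_integral (cst 0%E)) ?integral0// => x _.
by rewrite (nrm2_real 0) expr0n.
Qed.

End sqnorm.

(** A bounded operator has a closed kernel: if [g] in the kernel approximates [f], then [L i f]
    agrees a.e. with [L i (f - g)], whose norm is small. The invariant subspaces below are all
    common kernels of this kind; [C] bounds squared norms. *)
Lemma closed_subspace_ker d (T : measurableType d) (mu : probability T R)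
    d' (T' : measurableType d') (N : probability T' R)
    (I : Type) (J : set I) (L : I -> (T -> R[i]) -> (T' -> R[i])) (C : R) :
  0 <= C ->
  (forall i f, J i -> cmeasurable f -> cmeasurable (L i f)) ->
  (forall i f g x, J i -> L i (fun y => f y + g y) x = L i f x + L i g x) ->
  (forall i c f x, J i -> L i (fun y => c * f y) x = c * L i f x) ->
  (forall i f, J i -> cmeasurable f -> (sqnorm N (L i f) <= C%:E * sqnorm mu f)%E) ->
  closed_subspace mu [set f | inL2 mu f /\
    forall i, J i -> {ae N, forall x, L i f x = 0}].
Proof.
move=> C0 mL LD LZ LC; split.
- by move=> f [].
- split; first exact: inL20.
  move=> i Ji; apply: aeW => x.
  by have := LZ i 0 (fun=> 0) x Ji; rewrite !mul0r.
- move=> f g [f2 f0] [g2 g0]; split; first exact: inL2D.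
  by move=> i Ji; apply: filterS2 (f0 i Ji) (g0 i Ji) => x fx gx; rewrite LD// fx gx addr0.
- move=> c f [f2 f0]; split; first exact: inL2Z.
  by move=> i Ji; apply: filterS (f0 i Ji) => x fx; rewrite LZ// fx mulr0.
- move=> f f2 fV; split=> // i Ji; have [mf _] := f2.
  apply: sqnorm_eq0; first exact: mL.
  apply/eqP; rewrite eq_le sqnorm_ge0 andbT; apply/lee_addgt0Pr => e e0.
  rewrite add0e.
  (* The approximation is taken within [e / (C + 1)], since [C] may be zero. *)
  have C1 : 0 < C + 1 by rewrite ltr_wpDl.
  have [g [[mg _] g0] fg] := fV _ (divr_gt0 e0 C1).
  have mfg : cmeasurable (fun x => f x - g x).
    by apply: cmeasurableD => //; exact: cmeasurableN.
  rewrite (@ae_eq_sqnorm _ _ N _ (L i (fun x => f x - g x))).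
  + apply: le_trans (LC _ _ Ji mfg) _.
    apply: le_trans (lee_wpmul2l _ (ltW fg)) _; first by rewrite lee_fin.
    rewrite -EFinM lee_fin mulrA ler_pdivrMr// mulrC ler_pM2l//.
    by rewrite lerDl.
  + exact: mL.
  + exact: mL.
  + apply: filterS (g0 i Ji) => x gx.
    rewrite LD// (_ : (fun y => - g y) = (fun y => -1 * g y)).
      by rewrite LZ// gx mulr0 addr0.
    by apply/funext => y; rewrite mulN1r.
Qed.

End complex_L2.

(** * Invariant sets and invariant measures *)

Section almost_everywhere.
Context (R : realType).

Lemma ae_notin d (T : measurableType d) (mu : probability T R) (N : set T) :
  measurable N -> mu N = 0%E -> {ae mu, forall x, ~ N x}.
Proof. by move=> mN N0; exists N; split=> // x /= /contrapT. Qed.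

Lemma ae_notin0 d (T : measurableType d) (mu : probability T R) (N : set T) :
  measurable N -> {ae mu, forall x, ~ N x} -> mu N = 0%E.
Proof.
move=> mN aN; apply/(negligibleP _ mN); apply: negligibleS aN => x Nx /=.
by apply.
Qed.

Lemma ae_nonsingular d1 d2 (T1 : measurableType d1) (T2 : measurableType d2)
    (mu : probability T1 R) (M : probability T2 R) (a : T1 -> T2) (P : T2 -> Prop) :
  measurable_fun setT a -> nonsingular mu M a -> {ae M, forall x, P x} ->
  {ae mu, forall x, P (a x)}.
Proof.
move=> ma ns [N [mN N0 PN]]; exists (a @^-1` N); split.
- exact: measurable_preim.
- exact: ns.
- by move=> x /= nP; exact: PN.
Qed.

End almost_everywhere.

(** Exhaustion: a countable union of [nu]-null sets whose [mu]-measures approach the supremum is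
    [nu]-null and attains the supremum, so adding another [nu]-null set cannot increase its
    [mu]-measure. *)
Lemma maximal_null_set (R : realType) d (T : measurableType d)
    (mu nu : probability T R) :
  exists S, [/\ measurable S, nu S = 0%E &
    forall N, measurable N -> nu N = 0%E -> mu (N `\` S) = 0%E].
Proof.
pose E := [set mu N | N in [set N | measurable N /\ nu N = 0%E]].
have E0 : E 0%E by exists set0; [split; [exact: measurable0|exact: measure0]|exact: measure0].
have supE1 : (ereal_sup E <= 1)%E.
  by apply: ge_ereal_sup => _ [N [mN _] <-]; exact: probability_le1.
have fE : ereal_sup E \is a fin_num.
  rewrite ge0_fin_numE; first exact: le_lt_trans supE1 (ltry 1).
  exact: ereal_sup_ubound.
have [N NE] : {N : nat -> set T & forall n, [/\ measurable (N n), nu (N n) = 0%E &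
    (ereal_sup E - (n.+1%:R^-1)%:E < mu (N n))%E]}.
  apply: (@choice _ _ (fun n M => [/\ measurable M, nu M = 0%E &
    (ereal_sup E - (n.+1%:R^-1)%:E < mu M)%E])) => n.
  have n0 : (0 : R) < n.+1%:R^-1 by rewrite invr_gt0.
  have [_ [M [mM M0] <-] lt] := ub_ereal_sup_adherent n0 fE.
  by exists M; split.
exists (\bigcup_n N n); have mN : measurable (\bigcup_n N n).
  by apply: bigcup_measurable => n _; have [] := NE n.
have N0 : nu (\bigcup_n N n) = 0%E.
  apply/(negligibleP _ mN); apply: negligible_bigcup => n.
  by have [mNn ? _] := NE n; exact/negligibleP.
split=> // B mB B0; apply/eqP; rewrite eq_le measure_ge0 andbT.
have mBN := measurableD mB mN.
have fN : mu (\bigcup_n N n) \is a fin_num by exact: fin_num_measure.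
suff : (mu (B `\` \bigcup_n N n) + mu (\bigcup_n N n) <= mu (\bigcup_n N n))%E.
  by rewrite -leeBrDr// subee.
rewrite -measureU//; last by rewrite setDE -setIA setICl setI0.
apply: (@le_trans _ _ (ereal_sup E)).
  apply: ereal_sup_ubound; exists (B `\` \bigcup_n N n `|` \bigcup_n N n) => //.
  split; first exact: measurableU.
  apply/eqP; rewrite eq_le measure_ge0 andbT -(adde0 0%E) -[X in (_ <= X + _)%E]B0 -N0.
  apply: le_trans (measureU2 _ _ _) _ => //; rewrite leeD2r//.
  by apply: le_measure; rewrite ?inE//; exact: subDsetl.
apply/lee_addgt0Pr => e e0.
have [n] := ltr_add_invr e0; rewrite add0r => ne.
have [mNn _ /ltW] := NE n; rewrite leeBlDr// => /le_trans; apply.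
apply: leeD; last by rewrite lee_fin ltW.
by apply: le_measure; rewrite ?inE//; exact: bigcup_sup.
Qed.

(** * Consequences of irreducibility for an abstract group action *)

Section irreducible_actions.
Context (R : realType) d (T : measurableType d) (mu : probability T R).
Context (G : Type) (D : set G) (a b : G -> T -> T) (q : G -> T -> R).
Hypotheses (ma : forall s, measurable_fun setT (a s))
  (mb : forall s, measurable_fun setT (b s)).
Hypotheses (ab : forall s, cancel (a s) (b s)) (ba : forall s, cancel (b s) (a s)).
Hypotheses (nsa : forall s, D s -> nonsingular mu mu (a s))
  (nsb : forall s, D s -> nonsingular mu mu (b s)).
Hypothesis qd : forall s, D s -> sqrt_density mu mu (a s) (q s).
Hypothesis irr : irreducible mu D (fun s f x => (q s x)%:C%C * f (b s x)).

(** The operators are isometries: [q s ^+ 2] is the density of the image of [mu] under [a s], and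
    the change of variables cancels [b s] against [a s]. *)
Lemma inL2_rep s f : D s -> inL2 mu f ->
  inL2 mu (fun x => (q s x)%:C%C * f (b s x)).
Proof.
move=> Ds [mf f2]; have [mq q0 qE] := qd Ds.
have mfb : cmeasurable (fun x => f (b s x)) by exact: cmeasurable_comp.
split; first by apply: cmeasurableM => //; exact: cmeasurable_real.
rewrite sqnormE (eq_integral (fun x => (nrm2 (f (b s x)))%:E * (q s x ^+ 2)%:E)%E); last first.
  by move=> x _; rewrite nrm2M nrm2_real mulrC EFinM.
rewrite -(qE (fun x => (nrm2 (f (b s x)))%:E)); last 2 first.
- exact: emeasurable_nrm2.
- by move=> x; rewrite lee_fin nrm2_ge0.
by rewrite (eq_integral (fun x => (nrm2 (f x))%:E))// => x _; rewrite ab.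
Qed.

(** The functions vanishing a.e. outside [A] form an invariant subspace. It contains the indicator
    of [A], so [A] is null if the subspace is 0; if it is all of L^2, it contains the indicator of
    the complement, which is then null. *)
Lemma irreducible_zero_one A : measurable A ->
  (forall s, D s -> mu (A `\` a s @^-1` A) = 0%E) ->
  mu A = 0%E \/ mu (~` A) = 0%E.
Proof.
move=> mA invA.
have mnA := measurableC mA.
pose L (_ : unit) (f : T -> R[i]) x := (\1_(~` A) x)%:C%C * f x.
have m1 B : measurable B -> cmeasurable (fun x : T => (\1_B x : R)%:C%C).
  by move=> mB; apply: cmeasurable_real; exact: measurable_indic.
have indL2 B : measurable B -> inL2 mu (fun x => (\1_B x)%:C%C).
  move=> mB; split; first exact: m1.
  apply: (@le_lt_trans _ _ (\int[mu]_x 1)%E).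
    apply: ge0_le_integral => //.
    - by move=> x _; rewrite lee_fin nrm2_ge0.
    - by apply: emeasurable_nrm2; exact: m1.
    - move=> x _; rewrite lee_fin -/(nrm2 _) nrm2_real indicE.
      by case: (_ \in _); rewrite ?expr1n// expr0n.
  by rewrite integral_cst// mul1e ltey_eq fin_num_measure.
have cV : closed_subspace mu [set f | inL2 mu f /\
    forall i, [set: unit] i -> {ae mu, forall x, L i f x = 0}].
  apply: (@closed_subspace_ker _ _ _ _ _ _ _ _ _ _ 1) => //.
  - by move=> i f _ mf; apply: cmeasurableM => //; exact: m1.
  - by move=> i f g x _; rewrite /L mulrDr.
  - by move=> i c f x _; rewrite /L mulrCA.
  - move=> i f _ mf; rewrite mul1e; apply: le_sqnorm => //.
      by apply: cmeasurableM => //; exact: m1.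
    move=> x; rewrite /L nrm2M nrm2_real indicE.
    by case: (_ \in _); rewrite ?expr1n ?mul1r// expr0n mul0r nrm2_ge0.
have [] := irr cV.
- move=> s f Ds [f2 f0]; split; first exact: inL2_rep.
  move=> i _.
  have mAa : measurable (A `\` a s @^-1` A).
    by apply: measurableD => //; exact: measurable_preim.
  (* If [x] is outside [A] and [b s x] is in [A], then [x] lies in this null set, because
     [a s (b s x) = x]. *)
  have nsB : mu (b s @^-1` (A `\` a s @^-1` A)) = 0%E.
    by apply: nsb => //; exact: invA.
  have fb0 := ae_nonsingular (mb s) (nsb Ds) (f0 i I).
  apply: filterS2 (ae_notin (measurable_preim (mb s) mAa) nsB) fb0 => x Bx fb.
  rewrite /L indicE; have [xA|] := boolP (x \in ~` A); last by rewrite mul0r.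
  have bA : (b s x \in ~` A).
    rewrite inE/= => Ab; apply: Bx; split => //=.
    by rewrite ba; move: xA; rewrite inE.
  by move: fb; rewrite /L indicE bA !mul1r => ->; rewrite mulr0.
- move=> V0; left; apply: ae_notin0 => //.
  have /V0 : inL2 mu (fun x => (\1_A x)%:C%C) /\
      forall i, [set: unit] i -> {ae mu, forall x, L i (fun x => (\1_A x)%:C%C) x = 0}.
    split; first exact: indL2.
    move=> i _; apply: aeW => x; rewrite /L !indicE in_setC.
    by case: (_ \in _); rewrite ?mul0r ?mulr0.
  apply: filterS => x /eqP; rewrite indicE => + Ax; rewrite mem_set//.
  by rewrite eq_complex/= oner_eq0.
- move=> VE; right; apply: ae_notin0 => //.
  have : inL2 mu (fun x => (\1_(~` A) x)%:C%C) by exact: indL2.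
  rewrite -VE => -[_ /(_ tt I)].
  apply: filterS => x /eqP; rewrite /L indicE => + Ax; rewrite mem_set//.
  by rewrite mulr1 eq_complex/= oner_eq0.
Qed.

(** Let [c] be the mean of [u]. The sets where [u] lies above or below [c] are invariant, hence null
    or conull. Neither is conull, because [u - c] has integral zero. *)
Lemma invariant_ae_constant (u : T -> R) : mu.-integrable setT (EFin \o u) ->
  (forall s, D s -> {ae mu, forall x, u (a s x) = u x}) ->
  exists c, {ae mu, forall x, u x = c}.
Proof.
move=> iu uinv.
have mu_ : measurable_fun setT u by apply/measurable_EFinP; exact: measurable_int iu.
have iR := integrable_fin_num measurableT iu.
pose c := fine (\int[mu]_x (u x)%:E)%E; exists c.
have ic : mu.-integrable setT (EFin \o cst c) by exact: finite_measure_integrable_cst.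
(* The signs [e = 1] and [e = -1] give the two sets. *)
have key (e : R) : e != 0 -> mu [set x | 0 < e * (u x - c)] = 0%E.
  move=> e0; set A := [set x | _].
  pose v x := e * (u x - c).
  have mv : measurable_fun setT v.
    by apply: measurable_funM => //; exact: measurable_funB.
  have mA : measurable A.
    rewrite (_ : A = v @^-1` `]0, +oo[%classic).
      by apply: (measurable_preim mv).
    by apply/seteqP; split => x /=; rewrite in_itv/= andbT.
  have invA s : D s -> mu (A `\` a s @^-1` A) = 0%E.
    move=> Ds; apply: ae_notin0.
      by apply: measurableD => //; exact: measurable_preim.
    by apply: filterS (uinv s Ds) => x ux [Ax nA]; apply: nA; rewrite /A/= ux.
  have [//|nA0] := irreducible_zero_one mA invA.
  have vA := ae_notin (measurableC mA) nA0.
  have iv : (\int[mu]_x (v x)%:E)%E = 0%E.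
    rewrite (eq_integral (fun x => e%:E * ((u x)%:E - c%:E))%E)//.
    rewrite integralZl//; last exact: integrableB.
    rewrite integralB// integral_cst//= probability_setT mule1.
    by rewrite /c fineK// subee// mule0.
  have : {ae mu, forall x, setT x -> (v x)%:E = 0%E}.
    apply/(ae_eq_integral_abs mu measurableT); first exact/measurable_EFinP.
    rewrite -[RHS]iv; apply: ae_eq_integral => //.
    - by apply: measurableT_comp => //; exact/measurable_EFinP.
    - exact/measurable_EFinP.
    - apply: filterS vA => x /= /contrapT Ax _; rewrite /A/= in Ax.
      by rewrite gtr0_norm.
  move=> v0; apply: ae_notin0 => //; apply: filterS v0 => x /(_ I)[vx0].
  by rewrite /A/= -/(v x) vx0 ltxx.
have m2 (e : R) : measurable [set x | 0 < e * (u x - c)].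
  rewrite (_ : [set _ | _] = (fun x => e * (u x - c)) @^-1` `]0, +oo[%classic).
    apply: measurable_preim => //.
    by apply: measurable_funM => //; exact: measurable_funB.
  by apply/seteqP; split => x /=; rewrite in_itv/= andbT.
have k1 := key 1 (oner_neq0 _).
have k2 : mu [set x | 0 < -1 * (u x - c)] = 0%E by apply: key; rewrite oppr_eq0 oner_eq0.
apply: filterS2 (ae_notin (m2 _) k1) (ae_notin (m2 _) k2) => x /= /negP + /negP.
rewrite mul1r mulN1r -!leNgt => h1 h2; apply/eqP.
by rewrite eq_le -subr_le0 h1/= -subr_ge0 -oppr_le0.
Qed.

Lemma irreducible_ergodic : ergodic mu D a.
Proof.
move=> f [iR iI] finv.
have [|c cE] := invariant_ae_constant iR.
  by move=> s /finv; apply: filterS => x ->.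
have [|c' c'E] := invariant_ae_constant iI.
  by move=> s /finv; apply: filterS => x ->.
exists (c +i* c')%C; apply: filterS2 cE c'E => x.
by case: (f x) => u v /= -> ->.
Qed.

(* A nu-null set S that is maximal for mu is invariant mod mu, hence null or
   conull. *)
Lemma not_singular_dominates (nu : probability T R) :
  (forall s, D s -> nonsingular nu nu (b s)) ->
  ~ mutually_singular nu mu -> nonsingular mu nu id.
Proof.
move=> nsnub; apply: contra_notP.
have [S [mS nuS Smax]] := maximal_null_set mu nu.
have invS s : D s -> mu (S `\` a s @^-1` S) = 0%E.
  move=> Ds; rewrite (_ : _ `\` _ = a s @^-1` (b s @^-1` S `\` S)).
    have mbS := measurable_preim (mb s) mS.
    apply: nsa => //; first exact: measurableD.
    by apply: Smax => //; exact: nsnub.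
  by apply/seteqP; split => x /=; rewrite ab.
have [S0|S1] := irreducible_zero_one mS invS; last by move=> _; exists S; split.
case=> A mA A0 /=; apply/eqP; rewrite eq_le measure_ge0 andbT.
rewrite -(adde0 0%E) -{1}(Smax A mA A0) -S0.
apply: le_trans (measureU2 _ _ _) => //; last exact: measurableD.
apply: le_measure; rewrite ?inE//; first exact/measurableU/mS/measurableD.
by move=> x Ax; have [Sx|nSx] := pselect (S x); [right|left].
Qed.

End irreducible_actions.

Section sqrt_density_lemmas.
Context (R : realType).

Lemma sqrt_density_exists d1 d2 (T1 : measurableType d1) (T2 : measurableType d2)
    (mu : probability T1 R) (M : probability T2 R) (a : T1 -> T2) :
  measurable_fun setT a -> nonsingular mu M a -> exists w, sqrt_density mu M a w.
Proof.
move=> ma ns.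
pose aX : {mfun T1 >-> T2} := HB.pack a (isMeasurableFun.Build _ _ _ _ a ma).
by eexists; exact: (@sqrt_density_RN _ _ _ _ _ mu M aX).
Qed.

Context d (T : measurableType d).
Implicit Types (mu M : probability T R).

Lemma indic_preimage (U V : Type) (h : U -> V) (A : set V) (x : U) :
  \1_(h @^-1` A) x = \1_A (h x) :> R.
Proof. by rewrite !indicE; congr (_%:R); apply/idP/idP; rewrite !inE. Qed.

Lemma integral_preserving M (h : T -> T) (f : T -> \bar R) :
  measurable_fun setT h ->
  (forall A, measurable A -> M (h @^-1` A) = M A) ->
  measurable_fun setT f -> (forall x, 0 <= f x)%E ->
  (\int[M]_x f (h x) = \int[M]_x f x)%E.
Proof.
move=> mh hM mf f0.
pose hX : {mfun T >-> T} := HB.pack h (isMeasurableFun.Build _ _ _ _ h mh).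
rewrite -(ge0_integral_distribution hX mf f0); apply: eq_measure_integral => A mA _.
exact: hM.
Qed.

(** A density is determined a.e. by its integrals over measurable sets, and a nonnegative function
    by its square. Identities between square roots of densities thus reduce to identities between
    measures. *)
Lemma ae_eq_sqr_density M (u v : T -> R) :
  measurable_fun setT u -> measurable_fun setT v ->
  (forall x, 0 <= u x) -> (forall x, 0 <= v x) ->
  (\int[M]_x (u x ^+ 2)%:E < +oo)%E ->
  (forall A, measurable A -> \int[M]_x (\1_A x * u x ^+ 2)%:E =
    \int[M]_x (\1_A x * v x ^+ 2)%:E)%E ->
  {ae M, forall x, u x = v x}.
Proof.
move=> mu_ mv u0 v0 ufin uv.
have mu2 : measurable_fun setT (fun x => (u x ^+ 2)%:E).
  by apply/measurable_EFinP; exact: (measurable_funX 2 mu_).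
have mv2 : measurable_fun setT (fun x => (v x ^+ 2)%:E).
  by apply/measurable_EFinP; exact: (measurable_funX 2 mv).
have iu : M.-integrable setT (fun x => (u x ^+ 2)%:E).
  apply/integrableP; split => //; apply: le_lt_trans ufin.
  by rewrite le_eqVlt; apply/orP; left; apply/eqP; apply: eq_integral => x _;
    rewrite gee0_abs// lee_fin sqr_ge0.
have e (f : T -> R) A : measurable A ->
    (\int[M]_(x in A) (f x ^+ 2)%:E = \int[M]_x (\1_A x * f x ^+ 2)%:E)%E.
  move=> mA; rewrite integral_mkcond; apply: eq_integral => x _.
  by rewrite patchE indicE; case: ifPn => _; rewrite ?mul1r ?mul0r.
have : ae_eq M setT (fun x => (u x ^+ 2)%:E) (fun x => (v x ^+ 2)%:E).
  by apply: integral_ae_eq => // A _ mA; rewrite !e//; exact: uv.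
by apply: filterS => x /(_ I)[] /eqP; rewrite eqrXn2// => /eqP.
Qed.

Lemma sqrt_density_null mu M (w : T -> R) B : sqrt_density mu M id w ->
  measurable B -> mu B = 0%E -> {ae M, forall x, B x -> w x = 0}.
Proof.
move=> [mw w0 wE] mB B0.
have mf : measurable_fun setT (fun x => (\1_B x : R)%:E).
  by apply/measurable_EFinP; exact: measurable_indic.
have f0 x : (0 <= (\1_B x : R)%:E)%E by rewrite lee_fin.
have e : (\int[M]_x `|(\1_B x)%:E * (w x ^+ 2)%:E|)%E = 0%E.
  rewrite -B0 -[B in RHS]setIT -integral_indic//.
  rewrite [RHS](wE _ mf f0); apply: eq_integral => x _.
  by rewrite gee0_abs// mule_ge0// lee_fin sqr_ge0.
have mg : measurable_fun setT (fun x => (\1_B x)%:E * (w x ^+ 2)%:E : \bar R)%E.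
  apply: emeasurable_funM => //; apply/measurable_EFinP.
  exact: (measurable_funX 2 mw).
move/(ae_eq_integral_abs M measurableT mg): e.
apply: filterS => x /(_ I)/= + Bx; rewrite indicE mem_set// mul1e => -[/eqP].
by rewrite sqrf_eq0 => /eqP.
Qed.

(** By finiteness of [M], each difference has the common measure of [A] and [B] minus that of their
    intersection. *)
Lemma measure_setD_sym M A B : measurable A -> measurable B -> M A = M B ->
  M (A `\` B) = 0%E -> M (B `\` A) = 0%E.
Proof.
move=> mA mB AB AB0.
have D X Y : measurable X -> measurable Y ->
    (M (X `\` Y) = M X - M (X `&` Y))%E.
  by move=> mX mY; rewrite measureD// ltey_eq fin_num_measure.
by rewrite D// -AB setIC -D.
Qed.

End sqrt_density_lemmas.

(** * Measure-preserving maps normalized by an irreducible action *)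

Section normalized_transformations.
Context (R : realType) d (T : measurableType d) (mu : probability T R).
Context (G : Type) (D : set G) (a b : G -> T -> T) (q : G -> T -> R).
Hypotheses (ma : forall s, measurable_fun setT (a s))
  (mb : forall s, measurable_fun setT (b s)).
Hypotheses (ab : forall s, cancel (a s) (b s)) (ba : forall s, cancel (b s) (a s)).
Hypothesis qd : forall s, D s -> sqrt_density mu mu (a s) (q s).
Hypothesis irr : irreducible mu D (fun s f x => (q s x)%:C%C * f (b s x)).

Context (M : probability T R) (H : set (T -> T)).
Hypotheses (nsMa : forall s, D s -> nonsingular M M (a s))
  (nsMb : forall s, D s -> nonsingular M M (b s)).
Hypothesis muM : nonsingular mu M id.
Hypotheses (mH : forall h, H h -> measurable_fun setT h)
  (HM : forall h A, H h -> measurable A -> M (h @^-1` A) = M A)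
  (nsH : forall h, H h -> nonsingular mu mu h)
  (invH : forall h, H h ->
    exists g, [/\ measurable_fun setT g, cancel h g & cancel g h])
  (normH : forall s h, D s -> H h ->
    exists2 h', H h' & forall x, b s (h x) = h' (b s x)).

Let nsHM h : H h -> nonsingular M M h.
Proof. by move=> Hh A mA; rewrite HM. Qed.

Let sqr_EFin_measurable (u : T -> R) : measurable_fun setT u ->
  measurable_fun setT (fun x => (u x ^+ 2)%:E).
Proof. by move=> mu_; apply/measurable_EFinP; exact: (measurable_funX 2 mu_). Qed.

Let indicM_measurable A (u : T -> R) : measurable A -> measurable_fun setT u ->
  measurable_fun setT (fun x => (\1_A x * u x)%:E).
Proof.
move=> mA mu_; apply/measurable_EFinP; exact: measurable_funM.
Qed.

(** From [normH], [h (a s x) = a s (h' x)]. As [h'] preserves [M], the map [h] preserves the image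
    of [M] under [a s]; as [h] also preserves [M], it preserves the density of that image. *)
Lemma density_invariant s (sg : T -> R) h : D s -> H h ->
  sqrt_density M M (a s) sg -> {ae M, forall x, sg (h x) = sg x}.
Proof.
move=> Ds Hh [msg sg0 sgE].
have [h' Hh' bh] := normH Ds Hh.
have ha x : h (a s x) = a s (h' x) by rewrite -[LHS](ba s) bh ab.
have [g [mg hg gh]] := invH Hh.
have i1 (B : set T) (mB : measurable B) : measurable_fun setT (fun x => (\1_B x : R)%:E).
  by apply/measurable_EFinP; exact: measurable_indic.
have sgfin : (\int[M]_x (sg x ^+ 2)%:E = 1)%E.
  rewrite (eq_integral (fun x => 1 * (sg x ^+ 2)%:E)%E); last by move=> x _; rewrite mul1e.
  by rewrite -(sgE (fun=> 1%E))// integral_cst//= probability_setT mule1.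
have mh := mH Hh.
apply: ae_eq_sqr_density => //.
- exact: measurableT_comp.
- rewrite (@integral_preserving _ _ _ M h (fun x => (sg x ^+ 2)%:E))//.
  + by rewrite sgfin ltry.
  + by move=> A mA; exact: HM.
  + exact: sqr_EFin_measurable.
  + by move=> x; rewrite lee_fin sqr_ge0.
move=> A mA; have mgA := measurable_preim mg mA.
(* With the inverse [g] of [h], the indicator of [A] at [x] is that of the preimage of [A] under [g]
   at [h x]; the integrand is then a function of [h x]. *)
transitivity (\int[M]_x (\1_(g @^-1` A) x * sg x ^+ 2)%:E)%E.
  rewrite -(@integral_preserving _ _ _ M h
    (fun x => (\1_(g @^-1` A) x * sg x ^+ 2)%:E))//.
  + by apply: eq_integral => x _; rewrite indic_preimage hg.
  + by move=> B mB; exact: HM.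
  + by apply: indicM_measurable => //; exact: (measurable_funX 2 msg).
  + by move=> x; rewrite lee_fin mulr_ge0// sqr_ge0.
have aE B : measurable B -> (\int[M]_x (\1_B x * sg x ^+ 2)%:E =
    \int[M]_x (\1_B (a s x))%:E)%E.
  by move=> mB; rewrite (sgE (fun x => (\1_B x)%:E))//; exact: i1.
rewrite !aE//.
rewrite -(@integral_preserving _ _ _ M h'
  (fun x => (\1_(g @^-1` A) (a s x))%:E))//.
- by apply: eq_integral => x _; rewrite -ha indic_preimage hg.
- exact: mH.
- by move=> B mB; exact: HM.
- exact: (measurableT_comp (i1 _ mgA)).
Qed.

(** Both sides, squared, are the density with respect to [M] of the image of [mu] under [a s]: on
    the left through [mu], on the right by transporting [w ^+ 2] times [M]. This is why
    multiplication by [w] intertwines the two representations. *)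
Lemma density_cocycle s (w sg : T -> R) : D s ->
  sqrt_density mu M id w -> sqrt_density M M (a s) sg ->
  {ae M, forall x, q s x * w x = sg x * w (b s x)}.
Proof.
move=> Ds [mw w0 wE] [msg sg0 sgE]; have [mq q0 qE] := qd Ds.
have i1 (B : set T) (mB : measurable B) : measurable_fun setT (fun x => (\1_B x : R)%:E).
  by apply/measurable_EFinP; exact: measurable_indic.
have mwb : measurable_fun setT (fun x => w (b s x)) by exact: (measurableT_comp mw).
have qwE A : measurable A -> (\int[M]_x (\1_A x * (q s x * w x) ^+ 2)%:E =
    \int[mu]_x (\1_A (a s x))%:E)%E.
  move=> mA; rewrite (qE (fun x => (\1_A x)%:E))//; last exact: i1.
  rewrite (wE (fun x => (\1_A x)%:E * (q s x ^+ 2)%:E)%E); last 2 first.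
  - apply: emeasurable_funM; first exact: i1.
    exact: sqr_EFin_measurable.
  - by move=> x; rewrite mule_ge0// lee_fin sqr_ge0.
  by apply: eq_integral => x _; rewrite -!EFinM exprMn mulrA.
apply: ae_eq_sqr_density => //.
- exact: measurable_funM.
- exact: measurable_funM.
- by move=> x; rewrite mulr_ge0.
- by move=> x; rewrite mulr_ge0.
- rewrite (eq_integral (fun x => (\1_setT x * (q s x * w x) ^+ 2)%:E)); last first.
    by move=> x _; rewrite indicT mul1r.
  rewrite qwE// (eq_integral (fun=> 1%E)); last by move=> x _; rewrite indicT.
  by rewrite integral_cst//= probability_setT mule1 ltry.
- move=> A mA; rewrite qwE//.
  rewrite (wE (fun x => (\1_A (a s x))%:E)); last 2 first.
  + exact: (measurableT_comp (i1 _ mA)).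
  + by move=> x; rewrite lee_fin.
  transitivity (\int[M]_x ((\1_A (a s x) * w (b s (a s x)) ^+ 2)%:E))%E.
    by apply: eq_integral => x _; rewrite ab EFinM.
  rewrite (sgE (fun x => (\1_A x * w (b s x) ^+ 2)%:E)); last 2 first.
  + by apply: indicM_measurable => //; exact: (measurable_funX 2 mwb).
  + by move=> x; rewrite lee_fin mulr_ge0// sqr_ge0.
  apply: eq_integral => x _; rewrite -EFinM; congr EFin; ring.
Qed.

(* The functions f such that w f is H-invariant form an invariant closed
   subspace: w^2 M = mu identifies L^2(mu) with a subspace of L^2(M), where the
   representation becomes that of the quasi-invariant measure M, which is
   compatible with H. *)
Lemma irreducible_normalized h A : H h -> measurable A ->
  mu (A `\` h @^-1` A) = 0%E.
Proof.
move=> Hh mA.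
have i1 (B : set T) (mB : measurable B) : measurable_fun setT (fun x => (\1_B x : R)%:E).
  by apply/measurable_EFinP; exact: measurable_indic.
have [w wd] := sqrt_density_exists (@measurable_id _ _ _) muM.
have [mw w0 wE] := wd.
have mZ : measurable [set x | w x = 0] by exact: (measurable_preim mw (measurable_set1 0)).
(* [L h f] vanishes M-a.e. exactly when [w f] is [h]-invariant. *)
pose L (h : T -> T) (f : T -> R[i]) x :=
  (w (h x))%:C%C * f (h x) - (w x)%:C%C * f x.
have cw : cmeasurable (fun x => (w x)%:C%C) by exact: cmeasurable_real.
have cwf f : cmeasurable f -> cmeasurable (fun x => (w x)%:C%C * f x).
  by move=> mf; exact: cmeasurableM.
have sqw f : cmeasurable f -> sqnorm M (fun x => (w x)%:C%C * f x) = sqnorm mu f.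
  move=> mf; rewrite !sqnormE (wE (fun x => (nrm2 (f x))%:E)); last 2 first.
  - exact: emeasurable_nrm2.
  - by move=> x; rewrite lee_fin nrm2_ge0.
  by apply: eq_integral => x _; rewrite nrm2M nrm2_real mulrC EFinM.
have mL i f : H i -> cmeasurable f -> cmeasurable (L i f).
  move=> Hi mf; apply: cmeasurableD; last by apply: cmeasurableN; exact: cwf.
  by apply: (cmeasurable_comp (mH Hi) (cwf _ mf)).
have cV : closed_subspace mu [set f | inL2 mu f /\
    forall i, H i -> {ae M, forall x, L i f x = 0}].
  (* The constant is 2 + 2: [sqnormD] bounds the squared norm of the difference by twice that of
     each term, and both terms have squared norm [sqnorm mu f] because [i] preserves [M]. *)
  apply: (@closed_subspace_ker _ _ _ _ _ _ _ _ _ _ 4) => //.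
  - by move=> i f g x _; rewrite /L; ring.
  - by move=> i c f x _; rewrite /L; ring.
  - move=> i f Hi mf.
    have c1 : cmeasurable (fun x => (w (i x))%:C%C * f (i x)).
      exact: (cmeasurable_comp (mH Hi) (cwf _ mf)).
    apply: le_trans (sqnormD _ c1 (cmeasurableN (cwf _ mf))) _.
    rewrite [X in (_ + _ * X)%E](_ : _ = sqnorm mu f); last first.
      rewrite -sqw// !sqnormE; apply: eq_integral => x _.
      by rewrite nrm2N.
    rewrite [X in (_ * X + _)%E](_ : _ = sqnorm mu f); last first.
      rewrite -sqw// !sqnormE.
      rewrite (@integral_preserving _ _ _ M i (fun x => (nrm2 ((w x)%:C%C * f x))%:E))//.
      + exact: mH.
      + by move=> B mB; exact: HM.
      + by apply: emeasurable_nrm2; exact: cwf.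
      + by move=> x; rewrite lee_fin nrm2_ge0.
    rewrite -ge0_muleDl//.
    by rewrite -EFinD (_ : 2 + 2 = 4)//; ring.
have Z0 : mu [set x | w x = 0] = 0%E.
  have := wE (fun x => (\1_[set x | w x = 0] x)%:E).
  rewrite integral_indic//.
  rewrite setIT => ->//; last exact: i1.
  by rewrite (eq_integral (cst 0%E)) ?integral0// => x _; rewrite indicE;
    case: (boolP (x \in _)) => [/set_mem/= ->|_]; rewrite ?expr0n ?mule0 ?mul0e.
pose Z := [set x | w x = 0].
have w_neq0 : {ae mu, forall x, w x <> 0} by exact: ae_notin mZ Z0.
(* The preimage of [Z] under [i] is [mu]-null, so [w] vanishes on it M-a.e.; the other inclusion
   follows because [i] preserves [M]. *)
have Z_inv i : H i -> {ae M, forall x, w (i x) = 0 <-> w x = 0}.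
  move=> Hi; have mh := mH Hi; have miZ := measurable_preim mh mZ.
  have iZ := sqrt_density_null wd miZ (nsH Hi mZ Z0).
  have iZ0 : M (i @^-1` Z `\` Z) = 0%E.
    apply: ae_notin0; first exact: measurableD.
    by apply: filterS iZ => x Zx [/Zx].
  have Zi0 : M (Z `\` i @^-1` Z) = 0%E.
    by apply: measure_setD_sym => //; exact: HM.
  apply: filterS2 iZ (ae_notin (measurableD mZ miZ) Zi0) => x Zx nx; split=> // wx.
  by apply: contrapT => wix; apply: nx.
(* [w] times [fB B] is the indicator of [B] where [w] is nonzero and 0 elsewhere, the inverse of 0
   being 0. For [B = setT] this is the vector (d mu / d M)^(-1/2). *)
pose fB (B : set T) x : R[i] := (\1_B x * (w x)^-1)%:C%C.
have wfB B x : (w x)%:C%C * fB B x = (\1_B x * (w x != 0)%:R)%:C%C.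
  rewrite /fB -rmorphM/= mulrCA; congr (_ * _)%:C%C.
  by have [->|w0x] := eqVneq (w x) 0; rewrite ?mul0r// divff.
have fBL2 B : measurable B -> inL2 mu (fB B).
  move=> mB; have mfB : cmeasurable (fB B).
    apply: cmeasurable_real; apply: measurable_funM => //.
    rewrite (_ : (fun _ => _) = (@powR R ^~ (-1)) \o w).
      exact: (measurableT_comp (measurable_powR _) mw).
    by apply/funext => x /=; rewrite powR_inv1.
  split=> //; rewrite -sqw//; apply: (@le_lt_trans _ _ (sqnorm M (fun=> 1))).
    apply: le_sqnorm; [exact: cwf|exact: cmeasurable_cst|move=> x].
    rewrite wfB !nrm2_real indicE expr1n.
    by case: (_ \in _) (_ != _) => -[]; rewrite ?mul1r ?mul0r ?expr1n// expr0n.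
  rewrite sqnormE (eq_integral (fun=> 1%E)); last by move=> x _; rewrite nrm2_real expr1n.
  by rewrite integral_cst//= probability_setT mul1e ltry.
have fV B : measurable B -> (forall x, B x) -> inL2 mu (fB B) /\
    forall i, H i -> {ae M, forall x, L i (fB B) x = 0}.
  move=> mB BT; split; first exact: fBL2.
  move=> i Hi; apply: filterS (Z_inv i Hi) => x Zx.
  rewrite /L !wfB !indicE !mem_set// (_ : (w (i x) != 0) = (w x != 0)) ?subrr//.
  by congr negb; apply/eqP/eqP => /Zx.
have [] := irr cV.
(* After multiplication by [w] the image of [f] is [sg] times [w f] composed with [b s]. The factor
   [sg] is [i]-invariant, and [b s (i x) = i' (b s x)] reduces the other factor to the
   [i']-invariance of [w f]. *)
- move=> s f Ds [f2 fL]; split; first exact: (inL2_rep mb ab qd Ds).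
  move=> i Hi; have [i' Hi' bi] := normH Ds Hi.
  have [sg sgd] := sqrt_density_exists (ma s) (nsMa Ds).
  have coc := density_cocycle Ds wd sgd.
  have coci := ae_nonsingular (mH Hi) (nsHM Hi) coc.
  have inv := density_invariant Ds Hi sgd.
  have fb := ae_nonsingular (mb s) (nsMb Ds) (fL _ Hi').
  apply: filterS2 (filterI coc coci) (filterI inv fb) => x [] c ci [] v.
  rewrite /L bi => /eqP; rewrite subr_eq0 => /eqP e.
  have wq y z : (w y)%:C%C * ((q s y)%:C%C * z) = ((q s y * w y)%:C%C * z).
    by rewrite rmorphM/=; ring.
  rewrite !wq c ci v bi !rmorphM/= -!mulrA e subrr.
  by [].
(* The vector [fB setT] belongs to the subspace but vanishes only where [w] does, a [mu]-null
   set. *)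
- move=> V0; have fT := V0 _ (fV _ measurableT (fun=> I)).
  have : {ae mu, forall x : T, False}.
    apply: filterS2 fT w_neq0 => x /eqP.
    by rewrite /fB indicT mul1r eq_complex/= eqxx andbT invr_eq0 => /eqP.
  move=> F; apply: ae_notin0; last by apply: filterS F.
  by apply: measurableD => //; exact: measurable_preim (mH Hh) mA.
(* Membership of [fB A] makes the indicator of [A], restricted to [w != 0], invariant under [h]; a
   point of [A] leaving [A] under [h] must then satisfy [w x = 0]. *)
- move=> VE.
  have : [set f | inL2 mu f /\ forall i, H i -> {ae M, forall x, L i f x = 0}] (fB A).
    by rewrite VE; exact: fBL2.
  case=> _ /(_ h Hh)/(ae_nonsingular (@measurable_id _ _ _) muM) LA.
  apply: ae_notin0; first by apply: measurableD => //; exact: measurable_preim (mH Hh) mA.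
  apply: filterS2 LA w_neq0 => x + wx [Ax nAhx].
  rewrite /L !wfB indicE memNset// mul0r indicE mem_set// mul1r (introN eqP wx).
  by rewrite sub0r => /eqP; rewrite oppr_eq0 eq_complex/= oner_eq0.
Qed.

End normalized_transformations.

(** * Product measures on configurations *)

Section conf_measures.
Context (R : realType) (p : nat).

Definition box_set (I : choiceType) (J : seq I) (A : I -> set 'F_p) : set (conf I p) :=
  [set x | forall i, i \in J -> A i (x i)].

Lemma measurable_box_set (I : choiceType) (J : seq I) (A : I -> set 'F_p) :
  measurable (box_set J A).
Proof.
rewrite (_ : box_set J A =
    \bigcap_(i in [set i | i \in J]) [set x : conf I p | A i (x i)]).
  apply: fin_bigcap_measurable; first exact: finite_seq.
  by move=> i _; exact: measurable_coord.
by apply/seteqP; split.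
Qed.

(** Boxes on finitely many coordinates are closed under intersection and generate the
    sigma-algebra. *)
Lemma conf_measure_unique (I : choiceType) (m1 m2 : probability (conf I p) R) :
  (forall J A, uniq J -> m1 (box_set J A) = m2 (box_set J A)) ->
  forall B, measurable B -> m1 B = m2 B.
Proof.
move=> m12; pose G := [set B | exists J A, uniq J /\ B = @box_set I J A].
apply: (@measure_unique _ _ _ G (fun=> setT)).
- apply/seteqP; split.
    apply: smallest_sub; first exact: smallest_sigma_algebra.
    move=> _ [i [A ->]]; apply: sub_sigma_algebra; exists [:: i], (fun=> A).
    split=> //; apply/seteqP; split=> x /=; last by apply; rewrite inE.
    by move=> Ax j; rewrite inE => /eqP ->.
  apply: smallest_sub; first exact: sigma_algebra_measurable.
  by move=> _ [J [A [_ ->]]]; exact: measurable_box_set.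
- move=> _ _ [J [A [uJ ->]]] [J' [A' [uJ' ->]]].
  exists (undup (J ++ J')), (fun i => [set v | (i \in J -> A i v) /\ (i \in J' -> A' i v)]).
  split; first exact: undup_uniq.
  apply/seteqP; split=> x /=.
    by move=> [AJ AJ'] i _; split; [exact: AJ|exact: AJ'].
  move=> AA; split=> i iJ; have := AA i; rewrite mem_undup mem_cat iJ ?orbT.
    by case=> // + _; exact.
  by case=> // _; exact.
- move=> _; exists [::], (fun=> setT); split=> //.
  by apply/seteqP; split.
- by apply/seteqP; split=> // x _; exists 0%N.
- by move=> _ [J [A [uJ ->]]]; exact: m12.
- by move=> k; rewrite -ge0_fin_numE// fin_num_measure.
Qed.

Section splice.
Context (K I : choiceType) (e : K -> I) (pi : I -> option K).
Hypothesis piK : ocancel pi e.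

(** [pi] selects the coordinates read from [x], the others being read from [y]; [ocancel pi e] makes
    it injective where it is defined. *)
Definition splice (x : conf K p) (y : conf I p) : conf I p :=
  fun i => oapp x (y i) (pi i).

Definition splice_pair (z : conf K p * conf I p) := splice z.1 z.2.

Lemma measurable_splice : measurable_fun setT splice_pair.
Proof.
apply: measurable_conf => i v; rewrite /splice_pair /splice; case: (pi i) => [j|] /=.
- apply: (measurable_preim (@measurable_fst _ _ _ _) (measurable_coord j [set v])).
- apply: (measurable_preim (@measurable_snd _ _ _ _) (measurable_coord i [set v])).
Qed.

HB.instance Definition _ :=
  isMeasurableFun.Build _ _ _ _ _ measurable_splice.

Context (gamma : K -> probability 'F_p R) (alpha delta : I -> probability 'F_p R).
Context (Pg : probability (conf K p) R) (Pa mu : probability (conf I p) R).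
Hypotheses (PgE : is_product_measure gamma Pg) (PaE : is_product_measure alpha Pa)
  (muE : is_product_measure delta mu).
Hypothesis deltaE : forall i A, delta i A = oapp (gamma ^~ A) (alpha i A) (pi i).

(** [Pa] also carries the coordinates that [x] overwrites. They stay unconstrained, so a box pulls
    back to a product of two boxes and the measure factors. *)
Lemma splice_law B : measurable B ->
  mu B = (Pg \x Pa)%E (splice_pair @^-1` B).
Proof.
apply: (conf_measure_unique (m2 := distribution (Pg \x Pa)%E splice_pair)) => J A uJ.
rewrite /box_set muE// /distribution/= /pushforward.
pose JK := pmap pi J; pose JI := [seq i <- J | pi i == None].
rewrite (_ : _ @^-1` _ = box_set JK (A \o e) `*` box_set JI A); last first.
  apply/seteqP; split=> -[x y] /=.
    rewrite /box_set/= => mA; split=> i.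
      rewrite mem_pmap => /mapP[j jJ ji].
      have := piK j; rewrite -ji/= => ->.
      by have := mA j jJ; rewrite /splice_pair/= /splice -ji.
    rewrite mem_filter => /andP[/eqP iN iJ].
    by have := mA i iJ; rewrite /splice_pair/= /splice iN.
  move=> [/= Ax Ay] i iJ; rewrite /splice_pair/= /splice; have := piK i.
  case E : (pi i) => [k|]/= ki; last by apply: Ay; rewrite mem_filter E eqxx.
  by rewrite -ki; apply: Ax; rewrite mem_pmap -E map_f.
rewrite product_measure1E; [|exact: measurable_box_set..].
rewrite [X in (X * _)%E]PgE; last exact: (pmap_uniq piK).
rewrite [X in (_ * X)%E]PaE; last exact: filter_uniq.
rewrite big_pmap big_filter (bigID (fun i => pi i == None))/= muleC; congr (_ * _)%E.
  rewrite big_mkcond [RHS]big_mkcond; apply: eq_bigr => i _.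
  rewrite deltaE; have := piK i; case: (pi i) => [k|]//= ->.
  by [].
by apply: eq_bigr => i /eqP iN; rewrite deltaE iN.
Qed.

(** A set is null for a product measure if and only if almost all its sections are null. *)
Lemma splice_null B : measurable B -> mu B = 0%E <->
  {ae Pg, forall x, Pa [set y | B (splice x y)] = 0%E}.
Proof.
move=> mB; rewrite splice_law//.
set C := _ @^-1` B; have mC : measurable C by exact: measurable_preim measurable_splice mB.
have xC x : xsection C x = [set y | B (splice x y)].
  by apply/seteqP; split=> y; rewrite /xsection/= inE.
rewrite /product_measure1.
have mf : measurable_fun setT (Pa \o xsection C) by exact: measurable_fun_xsection.
have := ae_eq_integral_abs Pg measurableT mf.
rewrite (eq_integral (Pa \o xsection C)); last by move=> x _; rewrite gee0_abs.
case=> h1 h2; split.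
  by move=> /h1; apply: filterS => x /(_ Logic.I)/=; rewrite xC.
by move=> h; apply: h2; apply: filterS h => x + _; rewrite -xC.
Qed.

End splice.

Lemma box_set_gt0 (I : choiceType) (alpha : I -> probability 'F_p R)
    (mu : probability (conf I p) R) (J : seq I) (c : I -> 'F_p) :
  is_product_measure alpha mu -> (forall i v, (0 < alpha i [set v])%E) ->
  (0 < mu (box_set J (fun i => [set c i])))%E.
Proof.
move=> muE a0; rewrite (_ : box_set J _ = box_set (undup J) (fun i => [set c i])).
  rewrite muE ?undup_uniq//; elim: (undup J) => [|i s IH]; first by rewrite big_nil.
  by rewrite big_cons mule_gt0.
by apply/seteqP; split=> x xJ i iJ; apply: xJ; move: iJ; rewrite mem_undup.
Qed.

Lemma ae_exists d (T : measurableType d) (mu : probability T R) (B : set T) (P : T -> Prop) :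
  measurable B -> (0 < mu B)%E -> {ae mu, forall x, P x} -> exists2 x, B x & P x.
Proof.
move=> mB B0 aP; apply: contrapT => nP.
have : mu B = 0%E.
  apply: ae_notin0 => //; apply: filterS aP => x Px Bx.
  by apply: nP; exists x.
by move=> Bz; rewrite Bz ltxx in B0.
Qed.

(** Split the coordinates into [J] and the rest. The map [g] changes only the pattern on [J], so
    each section of the preimage of [A] is a section of [A]. *)
Lemma finitary_nonsingular (I : choiceType) (alpha : I -> probability 'F_p R)
    (mu : probability (conf I p) R) (J : seq I) (g : conf I p -> conf I p) :
  is_product_measure alpha mu -> (forall i v, (0 < alpha i [set v])%E) ->
  measurable_fun setT g ->
  (forall x i, i \notin J -> g x i = x i) ->
  (forall x y, {in J, x =1 y} -> {in J, g x =1 g y}) ->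
  nonsingular mu mu g.
Proof.
move=> muE a0 mg gJ gD A mA A0.
pose pi i := if i \in J then Some i else None.
have piK : ocancel pi id by move=> i; rewrite /pi; case: ifP.
have deltaE i (B : set 'F_p) : alpha i B = oapp (alpha ^~ B) (alpha i B) (pi i).
  by rewrite /pi; case: ifP.
have spliceN B (mB : measurable B) := splice_null piK muE muE muE deltaE mB.
have splice_out x x' y : {in J, x =1 x'} -> splice pi x y = splice pi x' y.
  by move=> xx'; apply/funext => i; rewrite /splice /pi; case: ifPn => //= /xx'.
(* Almost every section is null and depends only on the pattern on [J]; each pattern has positive
   probability, so every section is null. *)
have nullA x : mu [set y | A (splice pi x y)] = 0%E.
  have [x' xx' <-] := ae_exists (measurable_box_set _ _) (box_set_gt0 J x muE a0)
    ((spliceN A mA).1 A0).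
  by congr (mu _); apply/seteqP; split=> y /=; rewrite (splice_out x x')// => i /xx'.
apply/(spliceN _ (measurable_preim mg mA)); apply: aeW => x.
rewrite -[RHS](nullA (g x)); congr (mu _).
suff e y : g (splice pi x y) = splice pi (g x) y.
  by apply/seteqP; split=> y /=; rewrite e.
apply/funext => i; rewrite {2}/splice /pi; case: ifPn => [iJ|iJ] /=.
  by apply: gD => // j jJ; rewrite /splice /pi jJ.
by rewrite gJ// /splice /pi (negbTE iJ).
Qed.

End conf_measures.

(** * Right and left multiplication *)

Lemma finitary_entry (p : nat) (t : BN p) : B0 t ->
  exists N, forall j n, (N < n)%N -> entry t j n = (j == n)%:R.
Proof.
move=> /finite_seqP[X XE]; exists (\max_(i <- X) (val i).2) => j n Nn.
have [jn|nj] := ltnP j n; last by rewrite entry_diag.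
rewrite /entry insubT//= ltn_eqF//; apply: contrapT => /eqP tn.
have : [set` X] (Sub (j, n) jn : idx id) by rewrite -XE.
move=> /= iX; have := @leq_bigmax_seq _ (X) xpredT
  (fun i : idx id => (val i).2) _ iX isT.
by rewrite /= leqNgt Nn.
Qed.

Section right_nonsingular.
Context (R : realType) (K : countType) (r : K -> nat) (p : nat).
Hypothesis r_inj : injective r.

(** An entry in a column up to [N] lies in a row numbered below [N], and [r] is injective. *)
Lemma finite_columns N : exists J : seq (idx r), forall i, (i \in J) = ((val i).2 <= N)%N.
Proof.
have fX : finite_set [set i : idx r | ((val i).2 <= N)%N].
  pose f (i : idx r) := (r (val i).1, (val i).2).
  have fB : finite_set (`I_N `*` `I_N.+1) by apply: finite_setX; exact: finite_II.
  apply: sub_finite_set (finite_preimage (f := f) _ fB).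
    move=> i /= iN; split=> /=; last by rewrite ltnS.
    exact: leq_trans (valP i) iN.
  move=> i j _ _ [] /r_inj e1 e2; apply: val_inj.
  by rewrite [LHS]surjective_pairing e1 e2 -surjective_pairing.
have [X XE] := (finite_seqP _).1 fX; exists (X) => i.
apply/idP/idP => [iX|iN].
  by have : [set` X] i by []; rewrite -XE.
by have : [set i : idx r | ((val i).2 <= N)%N] i by []; rewrite XE.
Qed.

Lemma mulB_far (x : conf (idx r) p) (s : BN p) N (i : idx r) :
  (forall j n, (N < n)%N -> entry s j n = (j == n)%:R) -> (N < (val i).2)%N ->
  mulB x s i = x i.
Proof.
move=> sN Ni; rewrite /mulB (bigD1 ord_max)//= sN// eqxx mulr1 big1 ?addr0.
  by rewrite entry_idx.
by move=> j; rewrite -val_eqE/= sN// => /negbTE ->; rewrite mulr0.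
Qed.

Context (alpha : idx r -> probability 'F_p R) (mu : probability (conf (idx r) p) R).
Hypotheses (muE : is_product_measure alpha mu)
  (a0 : forall i v, (0 < alpha i [set v])%E).

(** The hypothesis concerns the action of [s] rather than its entries, so that it can be checked for
    [invB t] by cancelling [t]. *)
Lemma nonsingular_mulB (s : BN p) N :
  (forall (x : conf (idx r) p) i, (N < (val i).2)%N -> mulB x s i = x i) ->
  nonsingular mu mu (fun x : conf (idx r) p => mulB x s).
Proof.
move=> sN; have [J JE] := finite_columns N.
apply: (finitary_nonsingular (J := J) muE a0 (@measurable_mulB K r p s)).
- by move=> x i; rewrite JE -ltnNge; exact: sN.
- move=> x y xy i; rewrite JE => iN; apply: eq_bigr => j _; congr (_ * _).
  rewrite /entry; case: insubP => //= u _ uE; apply: xy.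
  rewrite JE (_ : (val u).2 = j); last exact: (congr1 snd uE).
  by apply: leq_trans iN; rewrite -ltnS.
Qed.

Lemma nonsingular_actRV t : B0 t -> nonsingular mu mu (actRV t).
Proof.
move=> /finitary_entry[N tN]; apply: (@nonsingular_mulB t N) => x i Ni.
exact: mulB_far tN Ni.
Qed.

Lemma nonsingular_actR t : B0 t -> nonsingular mu mu (actR t).
Proof.
move=> /finitary_entry[N tN]; apply: (@nonsingular_mulB (invB t) N) => x i Ni.
by rewrite -(mulB_far _ tN Ni) mulBA mulVB mulB1.
Qed.

End right_nonsingular.

Lemma orbit_average (R : realType) d (T : measurableType d) (mu : probability T R)
    (L : T -> T) n : measurable_fun setT L ->
  exists (M : probability T R) (c : R), 0 < c /\
    forall A, (M A = (\sum_(j < n.+1) mu (iter j L @^-1` A)) * c%:E)%E.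
Proof.
move=> mL; have mLj j : measurable_fun setT (iter j L).
  elim: j => [|j IH]; first exact: measurable_id.
  exact: (measurableT_comp mL IH).
pose Lj j : {mfun T >-> T} := HB.pack (iter j L) (isMeasurableFun.Build _ _ _ _ _ (mLj j)).
pose m : {measure set T -> \bar R} := msum (fun j => distribution mu (Lj j)) n.+1.
have mE A : m A = (\sum_(j < n.+1) mu (iter j L @^-1` A))%E by [].
have mT : m setT = n.+1%:R%:E.
  rewrite mE (eq_bigr (fun=> 1%E)) => [|j _]; last exact: probability_setT.
  by rewrite sumEFin sumr_const card_ord.
(* [mnormalize] falls back on [mu] only for total mass zero or infinity; here the mass is [n.+1]. *)
have nE A : mnormalize m mu A = (m A * (n.+1%:R^-1)%:E)%E.
  by rewrite /mnormalize mT ifF//= orbF eqe pnatr_eq0.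
exists (mnormalize m mu), n.+1%:R^-1.
by split=> [|A]; [rewrite invr_gt0|exact: nE].
Qed.

Lemma uniform_Fp_shift (R : realType) (p : nat) (A : set 'F_p) (c : 'F_p) :
  uniform_Fp R p [set v | A (v + c)] = uniform_Fp R p A.
Proof.
have atom v : uniform_Fp R p [set v] = (#|'F_p|%:R^-1)%:E.
  by rewrite /uniform_Fp /mscale/= /counting asboolT// fset_set1 finmap.cardfs1 mule1.
rewrite !probability_atoms; congr EFin.
rewrite (eq_bigr (fun=> #|'F_p|%:R^-1)); last by move=> v _; exact: (congr1 fine (atom v)).
rewrite [RHS](eq_bigr (fun=> #|'F_p|%:R^-1)); last by move=> v _; exact: (congr1 fine (atom v)).
rewrite [RHS](reindex_inj (addIr c)); apply: eq_bigl => v.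
by apply/idP/idP; rewrite !inE.
Qed.

Lemma uniform_Fp_gt0 (R : realType) (p : nat) (v : 'F_p) : (0 < uniform_Fp R p [set v])%E.
Proof.
rewrite /uniform_Fp /mscale/= /counting asboolT// fset_set1 finmap.cardfs1 mule1.
by rewrite lte_fin invr_gt0 ltr0n; apply/card_gt0P; exists 0.
Qed.

(** * Irreducibility on spaces of upper triangular arrays *)

Section irreducible_conf.
Context (R : realType) (K : countType) (r : K -> nat) (p : nat).
Hypothesis r_inj : injective r.
Notation X := (conf (idx r) p).
Context (alpha : idx r -> probability 'F_p R) (mu : probability X R).
Hypotheses (muE : is_product_measure alpha mu)
  (a0 : forall i v, (0 < alpha i [set v])%E).
Hypothesis irr : irreducible mu (@B0 p) (repR mu).

Let q (t : BN p) (x : X) := Num.sqrt (fine (Radon_Nikodym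
  (charge_of_finite_measure (distribution mu (actR t))) mu x)).

Let qd t : B0 t -> sqrt_density mu mu (actR t) (q t).
Proof. by move=> /(nonsingular_actR r_inj muE a0)/sqrt_density_RN. Qed.

Let irrq : irreducible mu (@B0 p) (fun s f x => (q s x)%:C%C * f (actRV s x)).
Proof. exact: irr. Qed.

Let ma (t : BN p) : measurable_fun setT (@actR K r p t).
Proof. exact: measurable_mulB. Qed.

Let mb (t : BN p) : measurable_fun setT (@actRV K r p t).
Proof. exact: measurable_mulB. Qed.

Let nsa t := @nonsingular_actR R K r p r_inj alpha mu muE a0 t.
Let nsb t := @nonsingular_actRV R K r p r_inj alpha mu muE a0 t.

Lemma irreducible_ergodic_conf : ergodic mu (@B0 p) (@actR K r p).
Proof. exact: (irreducible_ergodic ma mb (@actRK K r p) (@actRVK K r p) nsb qd irrq). Qed.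

(** The difference contains the box of points that vanish at [i] and on [J], which has positive
    measure. This contradicts triviality of [h] mod [mu]. *)
Lemma moved_not_null (h : X -> X) (J : seq (idx r)) (i : idx r) :
  measurable_fun setT h ->
  (forall x, {in J, forall j, x j = 0} -> h x i <> 0) ->
  mu ([set x | x i = 0] `\` h @^-1` [set x | x i = 0]) <> 0%E.
Proof.
move=> mh hi m0; have := box_set_gt0 (i :: J) (fun=> 0) muE a0.
have mi : measurable [set x : X | x i = 0] by exact: (measurable_coord i [set 0]).
have mB := measurable_box_set (i :: J) (fun=> [set (0 : 'F_p)]).
have mD : measurable ([set x : X | x i = 0] `\` h @^-1` [set x | x i = 0]).
  by apply: measurableD => //; exact: measurable_preim mh mi.
rewrite lt_neqAle => /andP[/eqP + _]; apply; apply/esym/eqP.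
rewrite eq_le measure_ge0 andbT -m0; apply: le_measure; rewrite ?inE//.
move=> x /= xJ; split=> /=; first by apply: xJ; rewrite inE eqxx.
by apply: hi => j jJ; apply: xJ; rewrite inE jJ orbT.
Qed.

(** Left multiplication enters only through commutation with right multiplication, periodicity and
    one moved coordinate, so both matrix spaces are covered at once. Without singularity, the orbit
    average [M] and [H = [set L]] meet the conditions of [irreducible_normalized], against
    [moved_not_null]. *)
Lemma periodic_commuting_singular (L : X -> X) n (J : seq (idx r)) (i : idx r) :
  measurable_fun setT L -> (forall x (s : BN p), mulB (L x) s = L (mulB x s)) ->
  (forall x, iter n.+1 L x = x) ->
  (forall x, {in J, forall j, x j = 0} -> L x i <> 0) ->
  mutually_singular (pushforward mu L) mu.
Proof.
move=> mL LC Ln Li; apply: contrapT => nsing.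
pose LX : {mfun X >-> X} := HB.pack L (isMeasurableFun.Build _ _ _ _ _ mL).
have iterC j x (s : BN p) : mulB (iter j L x) s = iter j L (mulB x s).
  by elim: j => //= j <-; rewrite LC.
have mLj j : measurable_fun setT (iter j L).
  elim: j => [|j IH]; first exact: measurable_id.
  exact: (measurableT_comp mL IH).
have preC j s A : iter j L @^-1` ((fun x : X => mulB x s) @^-1` A) =
    (fun x : X => mulB x s) @^-1` (iter j L @^-1` A).
  by apply/seteqP; split=> x /=; rewrite iterC.
have nsnu s : B0 s -> nonsingular (distribution mu LX) (distribution mu LX) (@actRV K r p s).
  move=> Ds A mA A0; rewrite -[LHS]/(mu (iter 1 L @^-1` ((fun x : X => mulB x s) @^-1` A))) preC.
  by apply: nsb => //; exact: measurable_preim mL mA.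
have nsL' : nonsingular mu (distribution mu LX) id.
  exact: (not_singular_dominates ma mb (@actRK K r p) (@actRVK K r p)
    nsa nsb qd irrq nsnu nsing).
have nsLj j A : measurable A -> mu (iter j L @^-1` A) = 0%E -> mu A = 0%E.
  elim: j A => [//|j IH] A mA A0; apply: nsL' => //.
  by apply: IH => //; exact: measurable_preim mL mA.
(* Absolute continuity is so far known from [mu] to its images. Used for the power [n] on the
   preimage of [A] under [L], it gives the reverse direction, since [L] after [iter n L] is the
   identity. *)
have nsL : nonsingular mu mu L.
  move=> A mA A0; apply: (nsLj n); first exact: measurable_preim mL mA.
  rewrite (_ : _ @^-1` _ = A)//.
  by apply/seteqP; split=> x /=; rewrite -[L _]/(iter n.+1 L x) Ln.
have [M [c [c0 ME]]] := orbit_average mu n mL.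
have MN A : measurable A -> M A = 0%E -> forall j : 'I_n.+1, mu (iter j L @^-1` A) = 0%E.
  move=> mA /eqP; rewrite ME mule_eq0 => /orP[/eqP s0 j|]; last by rewrite eqe gt_eqF.
  have le0 : (mu (iter j L @^-1` A) <= 0)%E.
    rewrite -s0 (bigD1 j)//= leeDl//; apply: sume_ge0 => k _; exact: measure_ge0.
  by apply/eqP; rewrite eq_le le0 measure_ge0.
have nsM s : nonsingular mu mu (fun x : X => mulB x s) -> nonsingular M M (fun x : X => mulB x s).
  move=> nss A mA A0; rewrite ME big1 ?mul0e// => j _.
  rewrite preC; apply: nss; last exact: MN.
  exact: measurable_preim (mLj j) mA.
suff : mu ([set x | x i = 0] `\` L @^-1` [set x | x i = 0]) = 0%E.
  exact: (moved_not_null mL Li).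
apply: (irreducible_normalized ma mb (@actRK K r p) (@actRVK K r p) qd irrq
  (M := M) (H := [set L])) => //.
- by move=> s /nsa; exact: nsM.
- by move=> s /nsb; exact: nsM.
- by move=> A mA A0 /=; exact: (MN _ mA A0 ord0).
- by move=> _ ->.
- move=> _ A -> mA; rewrite !ME; congr (_ * _)%E.
  (* Pulling back by [L] shifts the sum by one power; the last term, of power [n.+1], is the first
     one by periodicity. *)
  rewrite big_ord_recr [RHS]big_ord_recl/= addeC; congr (_ + _)%E.
    congr (mu _); apply/seteqP; split=> x /=; rewrite -[L (iter n L x)]/(iter n.+1 L x) Ln//.
- by move=> _ ->.
- move=> _ ->; exists (iter n L); split=> // x.
  by rewrite -iterSr Ln.
- by move=> s _ _ ->; exists L => // x; rewrite /actRV LC.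
- exact: (measurable_coord i [set 0]).
Qed.

Definition translate (v x : X) : X := fun i => x i + v i.

Lemma measurable_translate v : measurable_fun setT (translate v).
Proof.
apply: (@measurable_finitary _ _ _ _ (fun i => [:: i])) => i x y xy.
by rewrite /translate xy// inE.
Qed.

(** * Comparison of a single row with the uniform measure *)

Section uniform_row.
Context (k : K).

Definition uniformize_row (i : idx r) : probability 'F_p R :=
  if (val i).1 == k then uniform_Fp R p : probability 'F_p R else alpha i.

Let M : probability X R := product_measure uniformize_row.

Let in_row (v : X) := forall i, v i != 0 -> (val i).1 = k.

Let uniformize_row_gt0 i v : (0 < uniformize_row i [set v])%E.
Proof.
by rewrite /uniformize_row; case: ifP => _; [exact: uniform_Fp_gt0|exact: a0].
Qed.

(** In row [k] the factors are uniform, hence shift-invariant; in the other rows [v] vanishes. *)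
Let translate_M v A : in_row v -> measurable A -> M (translate v @^-1` A) = M A.
Proof.
move=> vk.
pose tX : {mfun X >-> X} := HB.pack (translate v)
  (isMeasurableFun.Build _ _ _ _ _ (measurable_translate v)).
apply: (conf_measure_unique (m1 := distribution M tX)) => J B uJ.
transitivity (M (box_set J (fun i => [set c | B i (c + v i)]))); first by [].
have ME : is_product_measure uniformize_row M by exact: product_measureP.
rewrite [LHS]ME// [RHS]ME//; apply: eq_bigr => i _.
rewrite /uniformize_row; case: ifPn => [_|ik]; first exact: uniform_Fp_shift.
congr (alpha i _); apply/seteqP; split=> c /=.
all: suff -> : v i = 0 by rewrite addr0.
all: by apply: contraNeq ik => /vk ->.
Qed.

(* The row vector v times s: the diagonal entry of v counts as 0, not as 1. *)
Let mul_row (v : X) (s : BN p) : X := fun i =>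
  \sum_(j < (val i).2.+1) oapp v 0 (insub ((val i).1, j : nat)) * entry s j (val i).2.

Let mulB_translate v s x : mulB (translate v x) s = translate (mul_row v s) (mulB x s).
Proof.
apply/funext => i; rewrite /mulB /translate /mul_row -big_split/=; apply: eq_bigr => j _.
rewrite -mulrDl; congr (_ * _); rewrite /entry; case: insub => //=.
by rewrite addr0.
Qed.

Let mul_row_in v s : in_row v -> in_row (mul_row v s).
Proof.
move=> vk i; apply: contraNeq => /eqP ik; apply/eqP/big1 => j _.
case: insubP => [u _ uE|_] /=; last by rewrite mul0r.
rewrite (_ : v u = 0) ?mul0r//; apply: contra_notP ik => /eqP/vk.
by rewrite (_ : (val u).1 = (val i).1)//; exact: (congr1 fst uE).
Qed.

Let first_in_row : (r (k, (r k).+1).1 < (k, (r k).+1).2)%N.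
Proof. exact: ltnSn. Qed.

Lemma irreducible_not_uniform_row : mutually_singular M mu.
Proof.
apply: contrapT => nsing.
have ME : is_product_measure uniformize_row M by exact: product_measureP.
have nsMa s := @nonsingular_actR R K r p r_inj _ M ME uniformize_row_gt0 s.
have nsMb s := @nonsingular_actRV R K r p r_inj _ M ME uniformize_row_gt0 s.
have muM : nonsingular mu M id.
  exact: (not_singular_dominates ma mb (@actRK K r p) (@actRVK K r p)
    nsa nsb qd irrq nsMb nsing).
(* Preservation of the null sets of [mu] is imposed, since [v] may have infinitely many nonzero
   entries. *)
pose H := [set h | exists v, [/\ in_row v, nonsingular mu mu (translate v) & h = translate v]].
pose i0 : idx r := Sub (k, (r k).+1) first_in_row.
(* The unit vector at the first entry of row [k]: its finite support makes the translation
   nonsingular, and it moves the value 0 at [i0] to 1. *)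
pose v0 : X := fun i => (i == i0)%:R.
have v0k : in_row v0 by move=> i; rewrite /v0; case: (i =P i0) => [->|]//; rewrite eqxx.
have v0ns : nonsingular mu mu (translate v0).
  apply: (finitary_nonsingular (J := [:: i0]) muE a0 (measurable_translate v0)).
    by move=> x i; rewrite inE /translate /v0 => /negbTE ->; rewrite addr0.
  by move=> x y xy i iJ; rewrite /translate xy.
suff : mu ([set x | x i0 = 0] `\` translate v0 @^-1` [set x | x i0 = 0]) = 0%E.
  apply: (@moved_not_null (translate v0) [:: i0] i0 (measurable_translate v0)).
  by move=> x x0; rewrite /translate /v0 eqxx x0 ?inE// add0r.
apply: (irreducible_normalized ma mb (@actRK K r p) (@actRVK K r p) qd irrq
  nsMa nsMb muM (H := H)).
- by move=> _ [v [_ _ ->]]; exact: measurable_translate.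
- by move=> _ A [v [vk _ ->]] mA; exact: translate_M.
- by move=> _ [v [_ nsv ->]].
- move=> _ [v [_ _ ->]]; exists (translate (fun i => - v i)); split.
  + exact: measurable_translate.
  + by move=> x; apply/funext => i; rewrite /translate addrK.
  + by move=> x; apply/funext => i; rewrite /translate addrNK.
- move=> s _ Ds [v [vk nsv ->]]; exists (translate (mul_row v s)).
    exists (mul_row v s); split=> //; first exact: mul_row_in.
    move=> A mA A0.
    (* Translation by [mul_row v s] is translation by [v] conjugated by right multiplication by [s],
       and all three maps are nonsingular for [mu]. *)
    rewrite (_ : _ @^-1` _ = actR s @^-1` (translate v @^-1` (@actRV K r p s @^-1` A))).
      have m1 := measurable_preim (mb s) mA.
      have m2 := measurable_preim (measurable_translate v) m1.
      by apply: nsa => //; apply: nsv => //; exact: nsb.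
    suff e x : translate (mul_row v s) x = actRV s (translate v (actR s x)).
      by apply/seteqP; split=> x /=; rewrite e.
    rewrite -[RHS]/(mulB (translate v (actR s x)) s) mulB_translate; congr translate.
    by rewrite -[LHS](actRK s).
  by move=> x; exact: mulB_translate.
- by exists v0.
- exact: (measurable_coord i0 [set 0]).
Qed.

Let row_entry_subproof (n : rowidx (r k)) : (r (k, val n).1 < (k, val n).2)%N.
Proof. exact: (valP n). Qed.

Definition row_entry (n : rowidx (r k)) : idx r := Sub (k, val n) (row_entry_subproof n).

Let row_pos (i : idx r) : option (rowidx (r k)) :=
  if (val i).1 == k then insub (val i).2 else None.

Let row_posK : ocancel row_pos row_entry.
Proof.
move=> i; rewrite /row_pos; case: ifPn => // /eqP ik.
case: insubP => //= n _ nE; apply: val_inj => /=.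
by rewrite nE -ik -surjective_pairing.
Qed.

Let row_pos_in i : (val i).1 = k -> row_pos i.
Proof.
move=> ik; rewrite /row_pos ik eqxx insubT//=.
by have := valP i; rewrite ik.
Qed.

(** Both [M] and [mu] arise by splicing a random row [k] into a [mu]-random array. Take [N] null for
    [M] and conull for [mu]: its section over a row is [mu]-null for almost every uniform row and
    [mu]-conull for almost every row of [mu]. No section is both, so a set of rows separates the two
    row measures. *)
Lemma irreducible_row_singular :
  mutually_singular
    (product_measure (fun n : rowidx (r k) => alpha (row_entry n)))
    (mu_inv R p (r k)).
Proof.
have [N [mN MN muN]] := irreducible_not_uniform_row.
set muk := product_measure _.
have dU i A : uniformize_row i A = oapp (fun=> uniform_Fp R p A) (alpha i A) (row_pos i).
  rewrite /uniformize_row; case: ifPn => [/eqP/row_pos_in|].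
    by case: row_pos.
  by rewrite /row_pos => /negbTE ->.
have da i A : alpha i A = oapp (fun n => alpha (row_entry n) A) (alpha i A) (row_pos i).
  by have := row_posK i; case: row_pos => //= n ->.
have UN := (splice_null row_posK (product_measureP (fun _ : rowidx (r k) =>
  uniform_Fp R p : probability 'F_p R)) muE (product_measureP uniformize_row) dU mN).1 MN.
have aN := (splice_null row_posK (product_measureP (fun n => alpha (row_entry n)))
  muE muE da (measurableC mN)).1 muN.
case: UN => S [mS S0 SN]; exists (~` S); split; first exact: measurableC.
  apply: ae_notin0; first exact: measurableC.
  apply: filterS aN => x nN nS; apply: nS; apply: SN => /= N0.
  have mx : measurable_fun setT (splice row_pos x).
    apply: (@measurable_finitary _ _ _ _ (fun i => [:: i])) => i y z yz.
    by rewrite /splice yz// inE.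
  have m1 := measurable_preim mx mN.
  have := @probability_setT _ _ _ mu.
  rewrite -(setUv (splice row_pos x @^-1` N)) measureU//; last 2 first.
  - exact: measurableC.
  - exact: setICr.
  move/eqP; rewrite preimage_setC [X in (X + _)%E]N0 [X in (_ + X)%E]nN adde0.
  by rewrite eq_sym onee_eq0.
by rewrite setCK.
Qed.

End uniform_row.
End irreducible_conf.

Lemma entry_column0 (K : countType) (r : K -> nat) p (J : seq (idx r)) n
    (x : conf (idx r) p) k :
  (forall i, (i \in J) = ((val i).2 <= n)%N) -> {in J, forall i, x i = 0} ->
  entry x k n = (r k == n)%:R.
Proof.
move=> JE xJ; have [kn|nk] := ltnP (r k) n; last by rewrite entry_diag.
by rewrite /entry insubT/= ltn_eqF// xJ// JE.
Qed.

(** Multiplication by a unit is injective on the finite set of matrices, so the orbit of [1%:M] is a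
    cycle. *)
Lemma mulmx_periodic (F : finFieldType) n (A : 'M[F]_n) : A \in unitmx ->
  exists q, iter q.+1 (mulmx A) 1%:M = 1%:M.
Proof.
move=> uA; have injA : injective (mulmx A : 'M[F]_n -> 'M[F]_n) by exact: can_inj (mulKmx uA).
exists (fingraph.order (mulmx A) 1%:M).-1.
by rewrite prednK ?fingraph.order_gt0// fingraph.iter_order.
Qed.

(** * Left multiplication on the first m rows *)

Section left_action_X.
Context (m p : nat) (t : 'M['F_p]_m).
Hypothesis tU : unitriangular t.

Lemma unitriangular_unit : t \in unitmx.
Proof.
rewrite unitmxE -det_tr det_trig.
  by rewrite big1 ?unitr1// => i _; rewrite !mxE tU// eqxx.
apply/is_trig_mxP => i j ij; rewrite !mxE tU; last exact: ltnW.
by rewrite -val_eqE/= gtn_eqF.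
Qed.

Lemma measurable_actLX : measurable_fun setT (actLX t).
Proof.
pose D (i : idx (@nat_of_ord m)) : seq (idx (@nat_of_ord m)) :=
  pmap insub [seq (j, (val i).2) | j <- enum 'I_m].
apply: (@measurable_finitary _ _ _ _ D) => i x y xy; apply: eq_bigr => j _.
congr (_ * _); rewrite /entry; case: insubP => //= u _ uE; apply: xy.
rewrite mem_pmap; apply/mapP; exists (sval u); last by rewrite valK.
by rewrite uE; apply/mapP; exists j => //; rewrite mem_enum.
Qed.

Lemma mulB_actLX (x : Xm m p) s : mulB (actLX t x) s = actLX t (mulB x s).
Proof.
apply: entryP => k n; rewrite (entry_mulB _ _ _ (leqnn n)) (entry_actLX _ _ _ tU).
under eq_bigr do rewrite (entry_actLX _ _ _ tU) mulr_suml.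
rewrite exchange_big; apply: eq_bigr => i _ /=.
rewrite (entry_mulB _ _ _ (leqnn n)) mulr_sumr.
by apply: eq_bigr => j _; rewrite mulrA.
Qed.

Lemma entry_iter_actLX q (x : Xm m p) k n :
  entry (iter q (actLX t) x) k n =
  \sum_(j < m) (iter q (mulmx t) 1%:M) k j * entry x j n.
Proof.
elim: q k => [|q IH] k /=.
  rewrite (bigD1 k)//= mxE eqxx mul1r big1 ?addr0// => j jk.
  by rewrite mxE eq_sym (negbTE jk) mul0r.
rewrite (entry_actLX _ _ _ tU).
transitivity (\sum_(l < m) \sum_(j < m)
    t k l * ((iter q (mulmx t) 1%:M) l j * entry x j n)).
  by apply: eq_bigr => l _; rewrite -mulr_sumr; congr (_ * _); exact: IH.
rewrite exchange_big; apply: eq_bigr => i _ /=.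
by rewrite mxE mulr_suml; apply: eq_bigr => j _; rewrite mulrA.
Qed.

Lemma actLX_periodic : exists q, forall x : Xm m p, iter q.+1 (actLX t) x = x.
Proof.
have [q tq] := mulmx_periodic unitriangular_unit; exists q => x.
apply: entryP => k n; rewrite entry_iter_actLX tq.
exact: esym (entry_iter_actLX 0 x k n).
Qed.

(** Choose [k < j] with [t k j] nonzero. If [x] vanishes above the diagonal in the columns up to
    [j], its column [j] is that of the identity, so the entry of the product at [(k, j)] is
    [t k j]. *)
Lemma actLX_moves : t <> 1%:M -> exists (J : seq (idx (@nat_of_ord m))) i,
  forall x : Xm m p, {in J, forall j, x j = 0} -> actLX t x i <> 0.
Proof.
move=> t1.
have [k [j tkj]] : exists k j, t k j != (k == j)%:R.
  apply: contrapT => nt; apply: t1; apply/matrixP => k j; rewrite mxE.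
  by apply: contrapT => /eqP tkj; apply: nt; exists k, j.
have kj : (k < j)%N by rewrite ltnNge; apply: contra tkj => /tU ->.
pose i : idx (@nat_of_ord m) := Sub (k, j : nat) kj.
have [J JE] := finite_columns (@ord_inj m) j.
exists J, i => x xJ; apply/eqP.
rewrite /actLX (bigD1 j)//= big1 ?addr0 => [|l lj]; rewrite (entry_column0 _ JE xJ).
  by rewrite eqxx mulr1; move: tkj; rewrite -[k == j]val_eqE ltn_eqF.
by rewrite [_ == _](negbTE lj) mulr0.
Qed.

End left_action_X.

(** * Left multiplication on infinite matrices *)

Section left_action_B.
Context (p : nat) (t : BN p).

Lemma mul1B (x : BN p) : mulB (oneB p) x = x.
Proof.
apply: entryP => k n; have [kn|nk] := leqP k n; last by rewrite !entry_diag// ltnW.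
rewrite (entry_mulB _ _ _ (leqnn n)) (bigD1 (Ordinal (kn : (k < n.+1)%N)))//=.
rewrite entry_oneB eqxx mul1r big1 ?addr0// => j.
by rewrite -val_eqE/= eq_sym entry_oneB => /negbTE ->; rewrite mul0r.
Qed.

Lemma measurable_actLB : measurable_fun setT (actLB t).
Proof.
pose D (i : idx (@id nat)) : seq (idx (@id nat)) :=
  pmap insub [seq (j, (val i).2) | j <- iota 0 (val i).2.+1].
apply: (@measurable_finitary _ _ _ _ D) => i x y xy; apply: eq_bigr => j _.
congr (_ * _); rewrite /entry; case: insubP => //= u _ uE; apply: xy.
rewrite mem_pmap; apply/mapP; exists (sval u); last by rewrite valK.
by rewrite uE; apply/mapP; exists (j : nat) => //; rewrite mem_iota add0n ltn_ord.
Qed.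

Lemma leading_mulB (s : BN p) N : leading (mulB t s) N = leading t N *m leading s N.
Proof.
apply/matrixP => i j; rewrite !mxE (@entry_mulB _ _ _ _ _ _ _ N).
  by apply: eq_bigr => k _; rewrite !mxE.
by rewrite -ltnS.
Qed.

Lemma iter_actLB q (x : BN p) : iter q (actLB t) x = mulB (iter q (actLB t) (oneB p)) x.
Proof. by elim: q => [|q IH] /=; rewrite ?mul1B// IH /actLB mulBA. Qed.

Lemma leading_iter q N :
  leading (iter q (actLB t) (oneB p)) N = iter q (mulmx (leading t N)) 1%:M.
Proof.
elim: q => [|q IH] /=; last by rewrite /actLB leading_mulB IH.
by apply/matrixP => i j; rewrite !mxE entry_oneB.
Qed.

(** Beyond column [N] the matrix [t] agrees with the identity, so the period is that of its leading
    block, which is a unit over a finite field. *)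
Lemma actLB_periodic : B0 t -> exists q, forall x : BN p, iter q.+1 (actLB t) x = x.
Proof.
move=> /finitary_entry[N tN].
have [q tq] := mulmx_periodic (leading_unit t N); exists q => x.
rewrite iter_actLB (_ : iter _ _ _ = oneB p) ?mul1B//.
apply: entryP => k n; rewrite entry_oneB.
have [nN|Nn] := leqP n N.
  have [kN|Nk] := leqP k N; last by rewrite entry_diag// ltnW// (leq_ltn_trans nN).
  have /matrixP/(_ (inord k) (inord n)) := leading_iter q.+1 N.
  by rewrite tq !mxE !inordK// -val_eqE/= !inordK.
(* In a column beyond [N], every power of [t] keeps the column of the identity. *)
elim: q.+1 k => [|q' IH] k; first by rewrite entry_oneB.
rewrite iterS /actLB (entry_mulB _ _ _ (leqnn n)) (bigD1 ord_max)//= IH eqxx mulr1.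
rewrite tN// big1 ?addr0// => j.
by rewrite -val_eqE/= IH => /negbTE ->; rewrite mulr0.
Qed.

Lemma actLB_moves : t <> oneB p -> exists (J : seq (idx (@id nat))) i,
  forall x : BN p, {in J, forall j, x j = 0} -> actLB t x i <> 0.
Proof.
move=> t1.
have [i ti] : exists i, t i != 0.
  apply: contrapT => nt; apply: t1; apply/funext => i; apply: contrapT => /eqP ti.
  by apply: nt; exists i.
have [J JE] := finite_columns (@inj_id nat) (val i).2.
exists J, i => x xJ; apply/eqP.
rewrite /actLB /mulB (bigD1 ord_max)//= big1 ?addr0 => [|l].
  by rewrite (entry_column0 _ JE xJ) eqxx mulr1 entry_idx.
by rewrite -val_eqE/= (entry_column0 _ JE xJ) => /negbTE ->; rewrite mulr0.
Qed.

End left_action_B.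

Theorem mainTheorem3 (R : realType) (p : nat) (p_prime : prime p) :
  (forall (m : nat) (m_gt0 : (0 < m)%N) (alpha : 'I_m -> nat -> probability 'F_p R)
     (alpha_gt0 : forall (k : 'I_m) n, (k < n)%N ->
        forall v : 'F_p, (0 < alpha k n [set v])%E),
   let mu : probability (Xm m p) R :=
     product_measure (fun i : idx (@nat_of_ord m) => alpha (val i).1 (val i).2) in
   irreducible mu (@B0 p) (repR mu) ->
   [/\ forall t : 'M['F_p]_m, unitriangular t -> t <> 1%:M ->
         mutually_singular (pushforward mu (actLX t)) mu,
       ergodic mu (@B0 p) (@actR 'I_m (@nat_of_ord m) p) &
       forall k : 'I_m,
         mutually_singular
           (product_measure (fun n : rowidx k => alpha k (val n)))
           (mu_inv R p k)])
  /\
  (forall (alpha : nat -> nat -> probability 'F_p R)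
     (alpha_gt0 : forall k n, (k < n)%N ->
        forall v : 'F_p, (0 < alpha k n [set v])%E),
   let mu : probability (BN p) R :=
     product_measure (fun i : idx (@id nat) => alpha (val i).1 (val i).2) in
   irreducible mu (@B0 p) (repR mu) ->
   (forall t : BN p, B0 t -> t <> oneB p ->
      mutually_singular (pushforward mu (actLB t)) mu) /\
   ergodic mu (@B0 p) (@actR nat (@id nat) p)).
Proof.
split.
- move=> m _ alpha alpha_gt0 mu irr.
  pose w (i : idx (@nat_of_ord m)) := alpha (val i).1 (val i).2.
  have muE : is_product_measure w mu by exact: product_measureP.
  have w0 i v : (0 < w i [set v])%E by apply: alpha_gt0; exact: (valP i).
  split.
  + move=> t tU t1; have [q tq] := actLX_periodic tU.
    have [J [i tJ]] := actLX_moves tU t1.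
    exact: (periodic_commuting_singular (@ord_inj m) muE w0 irr
      (measurable_actLX t) (mulB_actLX tU) tq tJ).
  + exact: (irreducible_ergodic_conf (@ord_inj m) muE w0 irr).
  + by move=> k; exact: (irreducible_row_singular (@ord_inj m) muE w0 irr k).
- move=> alpha alpha_gt0 mu irr.
  pose w (i : idx (@id nat)) := alpha (val i).1 (val i).2.
  have muE : is_product_measure w mu by exact: product_measureP.
  have w0 i v : (0 < w i [set v])%E by apply: alpha_gt0; exact: (valP i).
  split; last exact: (irreducible_ergodic_conf (@inj_id nat) muE w0 irr).
  move=> t t0 t1; have [q tq] := actLB_periodic t0.
  have [J [i tJ]] := actLB_moves t1.
  apply: (periodic_commuting_singular (@inj_id nat) muE w0 irr
    (measurable_actLB t) _ tq tJ).
  by move=> x s; exact: mulBA.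
Qed.
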